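(* For $C$ and $D$ each one of corollas, plane trees, weakly ordered trees, the set $\widetilde{C/D}$ of painted trees is in bijection with the set of structure types of the following substitution (partitional composition) of species, a painted tree with $n$ leaves corresponding to a structure type of order $n$: - $C$ = corollas: $L_+\circ L_+\circ L_+$ for $D$ = corollas; $Y\circ L_+\circ L_+$ for $D$ = plane trees; $F\circ L_+\circ L_+$ for $D$ = weakly ordered trees. - $C$ = plane trees: $L_+\circ L_+\circ Y=L_+\circ(2Y-x)$ for $D$ = corollas; $Y\circ L_+\circ Y=Y\circ(2Y-x)$ for $D$ = plane trees; $F\circ L_+\circ Y=F\circ(2Y-x)$ for $D$ = weakly ordered trees. - $C$ = weakly ordered trees: $L_+\circ(2F-x)$ for $D$ = corollas; $Y\circ(2F-x)$ for $D$ = plane trees; $F\circ(2F-x)$ for $D$ = weakly ordered trees.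
   Context: **Plane trees.** A plane tree is a finite rooted plane tree in which every node has at least two (linearly ordered) inputs; inputs not coming from another node are leaves, and the root has an output edge. The tree with one leaf and no node is allowed. A node $w$ is strictly above a node $v$ if $v\neq w$ lies on the path from $w$ to the root. A weak order on a set of nodes is a total preorder (an ordered partition of the set into levels), always required to satisfy: if $w$ is strictly above $v$ then the level of $w$ comes strictly after the level of $v$. A weakly ordered tree is a plane tree with a weak order on its nodes. **Painted trees.** A painted tree is a plane tree each of whose nodes is declared painted, half-painted or unpainted, such that if $w$ is strictly above $v$ and $v$ is half-painted or unpainted, then $w$ is unpainted. (An unpainted forest is grafted onto a painted base tree; the paint line meets each leaf-to-root path once, in the middle of an edge or at a half-painted node. There is one painted tree with one leaf.) Two non-painted nodes lie over the same base leaf if the path joining them in the tree meets no painted node. A painted tree of type $\widetilde{C/D}$ is a painted tree such that: if $D$ = corollas, there is at most one painted node; if $D$ = plane trees, no condition on painted nodes; if $D$ = weakly ordered trees, a weak order on the set of painted nodes is given; if $C$ = corollas, no unpainted node is strictly above another unpainted node; if $C$ = plane trees, no condition on unpainted nodes; if $C$ = weakly ordered trees, for each base leaf, a weak order on the unpainted nodes over that base leaf is given. **Species.** $L_+$ is the species of non-empty lists (linear orders), $Y$ the species of plane trees with labeled leaves, $F$ the species of weakly ordered trees with labeled leaves (labels placed bijectively on the leaves), and $x$ the singleton species. For $G=Y$ or $F$, which has exactly one structure on a singleton (the one-leaf tree), $2G-x$ denotes the species $G+G_{\ge 2}$, where $G_{\ge2}$ is the restriction of $G$ to sets of size at least $2$.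 Structure types of a species are the isomorphism classes of its structures (unlabeled structures). *)

(* Defs.v *)
From HB Require Import structures.
From mathcomp Require Import all_boot.
From mathcomp Require Import boolp.

Set Implicit Arguments.
Unset Strict Implicit.
Unset Printing Implicit Defensive.

(* Rooted plane trees with leaves labeled in L and nodes decorated in N. *)
Inductive tree (L N : Type) : Type :=
| Leaf of L
| Node of N & seq (tree L N).

Fixpoint leaves (L N : Type) (t : tree L N) : seq L :=
  match t with
  | Leaf l => [:: l]
  | Node _ ts => flatten (map (@leaves L N) ts)
  end.

Fixpoint map_leaves (L L' N : Type) (f : L -> L') (t : tree L N) : tree L' N :=
  match t with
  | Leaf l => Leaf N (f l)
  | Node c ts => Node c (map (map_leaves f) ts)
  end.

Fixpoint plane_tree (L N : Type) (t : tree L N) : bool :=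
  match t with
  | Leaf _ => true
  | Node _ ts => (1 < size ts) && all (@plane_tree L N) ts
  end.

(* A node is identified with its address: the sequence of the positions of the
   inputs to follow from the root in order to reach it. *)
Definition address := seq nat.

Fixpoint subtree (L N : Type) (t : tree L N) (v : address) : option (tree L N) :=
  match v with
  | [::] => Some t
  | i :: v' =>
      if t is Node _ ts then
        if onth ts i is Some u then subtree u v' else None
      else None
  end.

Definition decoration (L N : Type) (t : tree L N) (v : address) : option N :=
  if subtree t v is Some (Node c _) then Some c else None.

Definition is_node (L N : Type) (t : tree L N) (v : address) : bool :=
  isSome (decoration t v).

Definition strictly_above (w v : address) : bool := prefix v w && (v != w).

(* [r v w] reads "the level of v is at most the level of w".  The relation E
   tells which addresses are to be compared.  For E v w := S v /\ S w, this is a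
   weak order on S; if E is an equivalence relation on S, it amounts to a weak
   order on each class of E.  The relation r is false outside of E, so that
   equal weak orders are equal relations. *)
Definition weak_order (E : address -> address -> Prop) (r : rel address) : Prop :=
  [/\ forall v w, r v w -> E v w,
      forall v w, E v w -> r v w || r w v,
      transitive r
    & forall v w, E v w -> strictly_above w v -> r v w && ~~ r w v].

Inductive kind := Corollas | PlaneTrees | WeaklyOrderedTrees.

Inductive paint := Painted | HalfPainted | Unpainted.

Definition node_painted (t : tree unit paint) (v : address) : Prop :=
  decoration t v = Some Painted.

Definition node_unpainted (t : tree unit paint) (v : address) : Prop :=
  decoration t v = Some Unpainted.

Definition painting (t : tree unit paint) : Prop :=
  forall v w, is_node t v -> is_node t w -> strictly_above w v ->
    decoration t v = Some HalfPainted \/ decoration t v = Some Unpainted ->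
    decoration t w = Some Unpainted.

(* u is on the path joining v and w in the tree: it is below or equal to one of
   them, and not strictly below the node at which their paths to the root meet. *)
Definition on_path (v w u : address) : Prop :=
  (prefix u v || prefix u w) /\
  forall x, prefix x v -> prefix x w -> prefix x u.

Definition same_base_leaf (t : tree unit paint) (v w : address) : Prop :=
  forall u, on_path v w u -> ~ node_painted t u.

Definition base_structure (D : kind) (t : tree unit paint) : Type :=
  match D with
  | Corollas => forall v w, node_painted t v -> node_painted t w -> v = w
  | PlaneTrees => True
  | WeaklyOrderedTrees =>
      {r : rel address |
        weak_order (fun v w => node_painted t v /\ node_painted t w) r}
  end.

Definition forest_structure (C : kind) (t : tree unit paint) : Type :=
  match C with
  | Corollas => forall v w, node_unpainted t v -> node_unpainted t w ->
                  ~ strictly_above w v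
  | PlaneTrees => True
  | WeaklyOrderedTrees =>
      {r : rel address |
        weak_order (fun v w => [/\ node_unpainted t v, node_unpainted t w
                                 & same_base_leaf t v w]) r}
  end.

(* Painted trees of type C/D: the first parameter is the kind of the unpainted
   forest, the second one the kind of the painted base. *)
Record painted_tree (C D : kind) : Type := PaintedTree {
  ptree : tree unit paint;
  ptree_plane : plane_tree ptree;
  ptree_painting : painting ptree;
  ptree_forest : forest_structure C ptree;
  ptree_base : base_structure D ptree
}.

Definition num_leaves (C D : kind) (p : painted_tree C D) : nat :=
  size (leaves (ptree p)).

Record species : Type := Species {
  structures :> finType -> Type;
  transport : forall (A B : finType) (f : A -> B),
    bijective f -> structures A -> structures B;
  transport_id : forall (A : finType) (idP : bijective (@id A))
    (s : structures A), transport idP s = s;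
  transport_comp : forall (A B C : finType) (g : B -> C) (f : A -> B)
    (gP : bijective g) (fP : bijective f) (gfP : bijective (g \o f))
    (s : structures A), transport gfP s = transport gP (transport fP s)
}.

Arguments transport G {A B f} fP s : rename.

Definition species_iso (G H : species) : Prop :=
  exists eta : forall A : finType, G A -> H A,
    (forall A, bijective (eta A)) /\
    forall (A B : finType) (f : A -> B) (fP : bijective f) (s : G A),
      eta B (transport G fP s) = transport H fP (eta A s).

Definition structure (G : species) : Type := {A : finType & G A}.

Definition isomorphic (G : species) (s t : structure G) : Prop :=
  exists (f : projT1 s -> projT1 t) (fP : bijective f),
    transport G fP (projT2 s) = projT2 t.

(* An isomorphism class, as a predicate on the structures over all finite sets. *)
Record structure_type (G : species) : Type := StructureType {
  members : structure G -> Prop;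
  membersP : exists s, members = isomorphic s
}.

Definition has_order (G : species) (c : structure_type G) (n : nat) : Prop :=
  exists s, members c s /\ #|projT1 s| = n.

Lemma transport_ext (G : species) (A B : finType) (f g : A -> B)
    (fP : bijective f) (gP : bijective g) (s : G A) :
  f =1 g -> transport G fP s = transport G gP s.
Proof.
move=> fg; have {}fg : f = g by exact: funext.
by subst g; rewrite (Prop_irrelevance fP gP).
Qed.

Lemma transport_id1 (G : species) (A : finType) (f : A -> A)
    (fP : bijective f) (s : G A) : f =1 id -> transport G fP s = s.
Proof.
move=> f1; have idP : bijective (@id A) by exists id.
by rewrite (transport_ext fP idP s f1) transport_id.
Qed.

Lemma transport_comp1 (G : species) (A B C : finType) (h : A -> C) (g : B -> C)
    (f : A -> B) (hP : bijective h) (gP : bijective g) (fP : bijective f)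
    (s : G A) :
  h =1 g \o f -> transport G gP (transport G fP s) = transport G hP s.
Proof.
move=> hE; have gfP := bij_comp gP fP.
by rewrite -(transport_comp gP fP gfP); apply: transport_ext => x; rewrite hE.
Qed.

Section Sum.
Variables G H : species.

Definition sum_structures (A : finType) : Type := (G A + H A)%type.

Definition sum_transport (A B : finType) (f : A -> B) (fP : bijective f)
    (s : sum_structures A) : sum_structures B :=
  match s with
  | inl g => inl (transport G fP g)
  | inr h => inr (transport H fP h)
  end.

Lemma sum_transport_id (A : finType) (idP : bijective (@id A))
    (s : sum_structures A) : sum_transport idP s = s.
Proof. by case: s => s /=; rewrite transport_id. Qed.

Lemma sum_transport_comp (A B C : finType) (g : B -> C) (f : A -> B)
    (gP : bijective g) (fP : bijective f) (gfP : bijective (g \o f))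
    (s : sum_structures A) :
  sum_transport gfP s = sum_transport gP (sum_transport fP s).
Proof. by case: s => s /=; rewrite (transport_comp gP fP gfP). Qed.

Definition sum_species : species := Species sum_transport_id sum_transport_comp.

End Sum.

Section AtLeast2.
Variable G : species.

Definition ge2_structures (A : finType) : Type := {_ : G A | 1 < #|A|}.

Lemma ge2_bij (A B : finType) (f : A -> B) : bijective f -> 1 < #|A| -> 1 < #|B|.
Proof. by move=> fP; rewrite (bij_eq_card fP). Qed.

Definition ge2_transport (A B : finType) (f : A -> B) (fP : bijective f)
    (s : ge2_structures A) : ge2_structures B :=
  exist _ (transport G fP (proj1_sig s)) (ge2_bij fP (proj2_sig s)).

Lemma ge2_transport_id (A : finType) (idP : bijective (@id A))
    (s : ge2_structures A) : ge2_transport idP s = s.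
Proof. by case: s => s p; apply: eq_exist => /=; rewrite transport_id. Qed.

Lemma ge2_transport_comp (A B C : finType) (g : B -> C) (f : A -> B)
    (gP : bijective g) (fP : bijective f) (gfP : bijective (g \o f))
    (s : ge2_structures A) :
  ge2_transport gfP s = ge2_transport gP (ge2_transport fP s).
Proof. by apply: eq_exist => /=; rewrite (transport_comp gP fP gfP). Qed.

Definition ge2_species : species := Species ge2_transport_id ge2_transport_comp.

End AtLeast2.

(* This is 2G - x when G has exactly one structure on each singleton. *)
Definition twice_minus_x (G : species) : species := sum_species G (ge2_species G).

Definition subfin (T : finType) (X : {set T}) : finType := {x : T | x \in X}.

Section Restrict.
Variables (A B : finType) (f : A -> B) (X : {set A}) (Y : {set B}).
Hypothesis XY : forall x, (x \in X) = (f x \in Y).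

Lemma restrict_subproof (x : subfin X) : f (val x) \in Y.
Proof. by rewrite -XY; exact: (valP x). Qed.

Definition restrict (x : subfin X) : subfin Y :=
  exist _ (f (val x)) (restrict_subproof x).

Lemma restrict_bij : bijective f -> bijective restrict.
Proof.
move=> [g fK gK].
have gP (y : subfin Y) : g (val y) \in X by rewrite XY gK; exact: (valP y).
exists (fun y => exist _ (g (val y)) (gP y)) => x; apply: val_inj => /=.
  exact: fK.
exact: gK.
Qed.

End Restrict.

Section Substitution.
Variables G H : species.

Record subst_structures (A : finType) : Type := SubstStructure {
  blocks : {set {set A}};
  blocksP : partition blocks [set: A];
  outer : G (subfin blocks);
  inner : forall X : subfin blocks, H (subfin (val X))
}.

Lemma inner_eq (A : finType) (P : {set {set A}})
    (h : forall X : subfin P, H (subfin (val X))) (X Y : subfin P)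
    (e : forall x, (x \in val X) = (id x \in val Y))
    (eP : bijective (restrict e)) :
  X = Y -> transport H eP (h X) = h Y.
Proof.
by move=> XY; subst Y; apply: transport_id1 => x; apply: val_inj.
Qed.

Lemma subst_eq (A : finType) (s t : subst_structures A)
    (e : forall X, (X \in blocks s) = (id X \in blocks t))
    (eP : bijective (restrict e)) :
  transport G eP (outer s) = outer t ->
  (forall (X : subfin (blocks s)) (Y : subfin (blocks t))
     (d : forall x, (x \in val X) = (id x \in val Y))
     (dP : bijective (restrict d)),
     transport H dP (inner X) = inner Y) ->
  s = t.
Proof.
case: s e eP => [P pP g h] /= e eP; case: t e eP => [Q pQ g' h'] /= e eP.
have PQ : P = Q by apply/setP => X; rewrite e.
subst Q => gg' hh'.
have -> : pQ = pP by exact: Prop_irrelevance.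
have -> : g' = g by rewrite -gg'; apply: transport_id1 => X; apply: val_inj.
suff -> : h' = h by [].
apply: functional_extensionality_dep => X.
have d x : (x \in val X) = (id x \in val X) by [].
have dP : bijective (restrict d) by apply: restrict_bij; exists id.
by rewrite -(hh' X X d dP) (inner_eq h dP).
Qed.

Section Transport.
Variables (A B : finType) (f : A -> B) (fP : bijective f).

Definition image_blocks (P : {set {set A}}) : {set {set B}} :=
  [set f @: X | X : {set A} in P].

Lemma image_blocksP (P : {set {set A}}) :
  partition P [set: A] -> partition (image_blocks P) [set: B].
Proof.
move=> pP; have fI := bij_inj fP.
have -> : [set: B] = f @: [set: A].
  apply/setP => y; rewrite inE; case: fP => g fK gK; apply/esym/imsetP.
  by exists (g y); rewrite ?inE ?gK.
by rewrite imset_partition // => x y _ _; exact: fI.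
Qed.

Lemma imset_bij : bijective (fun X : {set A} => f @: X).
Proof.
have fI := bij_inj fP; exists (fun Y : {set B} => f @^-1: Y : {set A}) => X.
  by apply/setP => x; rewrite inE mem_imset.
case: fP => g fK gK; apply/setP => y; apply/imsetP/idP => [[x]|Xy].
  by rewrite inE => ? ->.
by exists (g y); rewrite ?inE gK.
Qed.

Lemma mem_image_blocks (P : {set {set A}}) (X : {set A}) :
  (X \in P) = (f @: X \in image_blocks P).
Proof. by rewrite mem_imset //; exact: (bij_inj imset_bij). Qed.

Lemma mem_preimage_block (P : {set {set A}}) (Y : subfin (image_blocks P)) :
  f @^-1: val Y \in P.
Proof.
case: Y => Y /= /imsetP[X XP ->].
suff -> : f @^-1: (f @: X) = X by [].
by apply/setP => x; rewrite inE mem_imset //; exact: (bij_inj fP).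
Qed.

Definition preimage_block (P : {set {set A}}) (Y : subfin (image_blocks P)) :
  subfin P := exist _ (f @^-1: val Y) (mem_preimage_block Y).

Lemma mem_preimset (Y : {set B}) (x : A) : (x \in f @^-1: Y) = (f x \in Y).
Proof. by rewrite inE. Qed.

Definition subst_transport (s : subst_structures A) : subst_structures B :=
  @SubstStructure B (image_blocks (blocks s)) (image_blocksP (blocksP s))
    (transport G (restrict_bij (mem_image_blocks (blocks s)) imset_bij) (outer s))
    (fun Y => transport H (restrict_bij (mem_preimset (val Y)) fP)
                (inner (preimage_block Y))).

End Transport.

Lemma subst_transport_id (A : finType) (idP : bijective (@id A))
    (s : subst_structures A) : subst_transport idP s = s.
Proof.
have e X : (X \in blocks (subst_transport idP s)) = (id X \in blocks s).
  by rewrite [RHS](mem_image_blocks idP) imset_id.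
apply: (@subst_eq _ _ _ e (restrict_bij e _)) => [|eP|]; first by exists id.
  rewrite /= ; set a := restrict_bij _ _; set b := restrict_bij _ _.
  have cP : bijective (@id (subfin (blocks s))) by exists id.
  rewrite (transport_comp1 cP) ?transport_id // => X.
  by apply: val_inj; rewrite /= imset_id.
move=> X Y d dP /=; set a := restrict_bij _ _.
have XY : forall x, (x \in val (preimage_block idP X)) = (id x \in val Y).
  by move=> x; rewrite -d inE.
have XYP : bijective (restrict XY) by apply: restrict_bij; exists id.
rewrite (transport_comp1 XYP); last by move=> x; apply: val_inj.
by apply: inner_eq; apply: val_inj; apply/setP => x; rewrite XY.
Qed.

Lemma subst_transport_comp (A B C : finType) (g : B -> C) (f : A -> B)
    (gP : bijective g) (fP : bijective f) (gfP : bijective (g \o f))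
    (s : subst_structures A) :
  subst_transport gfP s = subst_transport gP (subst_transport fP s).
Proof.
have e X : (X \in blocks (subst_transport gfP s))
         = (id X \in blocks (subst_transport gP (subst_transport fP s))).
  rewrite /=; suff -> : image_blocks (g \o f) (blocks s)
          = image_blocks g (image_blocks f (blocks s)) by [].
  rewrite /image_blocks -imset_comp; apply: eq_imset => Y.
  by rewrite /= imset_comp.
apply: (@subst_eq _ _ _ e (restrict_bij e _)) => [|/=|]; first by exists id.
  move=> idP; set a := restrict_bij e idP.
  set b := restrict_bij (mem_image_blocks gfP _) _.
  rewrite !(transport_comp1 (bij_comp a b)) // => X.
  by apply: val_inj; rewrite /= imset_comp.
move=> X Y d dP /=; set a := restrict_bij (mem_preimset (g \o f) (val X)) _.
set b := restrict_bij (mem_preimset g (val Y)) _.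
set c := restrict_bij _ fP.
rewrite (transport_comp1 (bij_comp dP a)) // (transport_comp1 (bij_comp b c)) //.
set X' := preimage_block _ X; set Y' := preimage_block _ _.
have XY x : (x \in val X') = (id x \in val Y') by rewrite !inE d.
have XYP : bijective (restrict XY) by apply: restrict_bij; exists id.
have XYE : X' = Y' by apply: val_inj; apply/setP => x; rewrite XY.
rewrite -(inner_eq _ XYP XYE) (transport_comp1 (bij_comp dP a)) // => x.
exact: val_inj.
Qed.

Definition subst_species : species :=
  Species subst_transport_id subst_transport_comp.

End Substitution.

Lemma perm_enum_map (A B : finType) (f : A -> B) (s : seq A) :
  bijective f -> perm_eq s (enum A) -> perm_eq (map f s) (enum B).
Proof.
move=> fP sA; have [g fK gK] := fP.
have sU : uniq s by rewrite (perm_uniq sA) enum_uniq.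
apply: uniq_perm; rewrite ?(map_inj_uniq (bij_inj fP)) ?enum_uniq // => y.
rewrite mem_enum inE; apply/mapP; exists (g y); rewrite ?gK //.
by rewrite (perm_mem sA) mem_enum inE.
Qed.

Section Lists.

Definition list_structures (A : finType) : Type :=
  {s : seq A | (s != [::]) && perm_eq s (enum A)}.

Lemma list_map_subproof (A B : finType) (f : A -> B) (s : list_structures A) :
  bijective f ->
  (map f (proj1_sig s) != [::]) && perm_eq (map f (proj1_sig s)) (enum B).
Proof.
case: s => s /= /andP[s0 sA] fP; rewrite perm_enum_map // andbT.
by case: s s0 {sA}.
Qed.

Definition list_transport (A B : finType) (f : A -> B) (fP : bijective f)
    (s : list_structures A) : list_structures B :=
  exist _ (map f (proj1_sig s)) (list_map_subproof s fP).

Lemma list_transport_id (A : finType) (idP : bijective (@id A))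
    (s : list_structures A) : list_transport idP s = s.
Proof. by case: s => s sA; apply: eq_exist; rewrite /= map_id. Qed.

Lemma list_transport_comp (A B C : finType) (g : B -> C) (f : A -> B)
    (gP : bijective g) (fP : bijective f) (gfP : bijective (g \o f))
    (s : list_structures A) :
  list_transport gfP s = list_transport gP (list_transport fP s).
Proof. by apply: eq_exist; rewrite /= map_comp. Qed.

Definition L_plus : species := Species list_transport_id list_transport_comp.

End Lists.

Section TreeMap.
Variable N : Type.

Lemma tree_rect_all (L : Type) (P : tree L N -> Prop) :
  (forall l, P (Leaf N l)) ->
  (forall c ts, foldr (fun t Q => P t /\ Q) True ts -> P (Node c ts)) ->
  forall t, P t.
Proof.
move=> PL PN; fix IH 1 => -[l|c ts]; first exact: PL.
by apply: PN; elim: ts => [|t ts IHts] //=; split.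
Qed.

Lemma map_leaves_id (L : Type) (t : tree L N) : map_leaves id t = t.
Proof.
elim/tree_rect_all: t => [l|c ts IH] //=; congr Node.
by elim: ts IH => [|t ts IHts] //= [-> /IHts ->].
Qed.

Lemma map_leaves_comp (L L' L'' : Type) (g : L' -> L'') (f : L -> L')
    (t : tree L N) : map_leaves (g \o f) t = map_leaves g (map_leaves f t).
Proof.
elim/tree_rect_all: t => [l|c ts IH] //=; congr Node.
by elim: ts IH => [|t ts IHts] //= [-> /IHts ->].
Qed.

Variables (L L' : Type) (f : L -> L').

Lemma leaves_map (t : tree L N) : leaves (map_leaves f t) = map f (leaves t).
Proof.
elim/tree_rect_all: t => [l|c ts IH] //=.
by elim: ts IH => [|t ts IHts] //= [-> /IHts ->]; rewrite map_cat.
Qed.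

Lemma plane_tree_map (t : tree L N) : plane_tree (map_leaves f t) = plane_tree t.
Proof.
elim/tree_rect_all: t => [l|c ts IH] //=; rewrite size_map; congr andb.
by elim: ts IH => [|t ts IHts] //= [-> /IHts ->].
Qed.

Lemma decoration_map (t : tree L N) (v : address) :
  decoration (map_leaves f t) v = decoration t v.
Proof.
elim: v t => [|i v IHv] [l|c ts] //=; rewrite /decoration /=.
by elim: ts i => [|t ts IHts] [|i] //=; exact: IHv.
Qed.

Lemma is_node_map (t : tree L N) : is_node (map_leaves f t) =1 is_node t.
Proof. by move=> v; rewrite /is_node decoration_map. Qed.

End TreeMap.

Definition labeled_by (A : finType) (t : tree A unit) : bool :=
  plane_tree t && perm_eq (leaves t) (enum A).

Lemma labeled_by_map (A B : finType) (f : A -> B) (t : tree A unit) :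
  bijective f -> labeled_by t -> labeled_by (map_leaves f t).
Proof.
move=> fP /andP[tP tA].
by rewrite /labeled_by plane_tree_map tP leaves_map perm_enum_map.
Qed.

Section PlaneTrees.

Definition plane_structures (A : finType) : Type :=
  {t : tree A unit | labeled_by t}.

Definition plane_transport (A B : finType) (f : A -> B) (fP : bijective f)
    (s : plane_structures A) : plane_structures B :=
  exist _ (map_leaves f (proj1_sig s)) (labeled_by_map fP (proj2_sig s)).

Lemma plane_transport_id (A : finType) (idP : bijective (@id A))
    (s : plane_structures A) : plane_transport idP s = s.
Proof. by case: s => t tA; apply: eq_exist; rewrite /= map_leaves_id. Qed.

Lemma plane_transport_comp (A B C : finType) (g : B -> C) (f : A -> B)
    (gP : bijective g) (fP : bijective f) (gfP : bijective (g \o f))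
    (s : plane_structures A) :
  plane_transport gfP s = plane_transport gP (plane_transport fP s).
Proof. by apply: eq_exist; rewrite /= map_leaves_comp. Qed.

Definition Y : species := Species plane_transport_id plane_transport_comp.

End PlaneTrees.

Section WeaklyOrderedTrees.

Definition node_weak_order (L N : Type) (t : tree L N) (r : rel address) : Prop :=
  weak_order (fun v w => is_node t v /\ is_node t w) r.

Lemma node_weak_order_map (L L' N : Type) (f : L -> L') (t : tree L N)
    (r : rel address) :
  node_weak_order t r -> node_weak_order (map_leaves f t) r.
Proof. by case=> rE rT rC rA; split=> // v w; rewrite !is_node_map; auto. Qed.

Record weakly_ordered_structures (A : finType) : Type := WeaklyOrdered {
  wo_tree : tree A unit;
  wo_rel : rel address;
  wo_treeP : labeled_by wo_tree;
  wo_relP : node_weak_order wo_tree wo_rel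
}.

Lemma weakly_ordered_eq (A : finType) (s t : weakly_ordered_structures A) :
  wo_tree s = wo_tree t -> wo_rel s = wo_rel t -> s = t.
Proof.
case: s => s r sP rP; case: t => t q tP qP /= st rq; subst t q.
by rewrite (Prop_irrelevance sP tP) (Prop_irrelevance rP qP).
Qed.

Definition weakly_ordered_transport (A B : finType) (f : A -> B)
    (fP : bijective f) (s : weakly_ordered_structures A) :
    weakly_ordered_structures B :=
  @WeaklyOrdered B (map_leaves f (wo_tree s)) (wo_rel s)
    (labeled_by_map fP (wo_treeP s)) (node_weak_order_map f (wo_relP s)).

Lemma weakly_ordered_transport_id (A : finType) (idP : bijective (@id A))
    (s : weakly_ordered_structures A) : weakly_ordered_transport idP s = s.
Proof. by apply: weakly_ordered_eq; rewrite //= map_leaves_id. Qed.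

Lemma weakly_ordered_transport_comp (A B C : finType) (g : B -> C) (f : A -> B)
    (gP : bijective g) (fP : bijective f) (gfP : bijective (g \o f))
    (s : weakly_ordered_structures A) :
  weakly_ordered_transport gfP s =
  weakly_ordered_transport gP (weakly_ordered_transport fP s).
Proof. by apply: weakly_ordered_eq; rewrite //= map_leaves_comp. Qed.

Definition F : species :=
  Species weakly_ordered_transport_id weakly_ordered_transport_comp.

End WeaklyOrderedTrees.

Definition types_of_painted_trees (C D : kind) (G : species) : Prop :=
  exists Phi : painted_tree C D -> structure_type G,
    bijective Phi /\ forall p, has_order (Phi p) (num_leaves p).

Declare Scope species_scope.
Delimit Scope species_scope with species.
Bind Scope species_scope with species.
Infix "⊙" := subst_species (at level 40, left associativity) : species_scope.
Infix "≅" := species_iso (at level 70) : species_scope.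

(* Main.v *)
(* A structure of L_+, Y or F on A amounts to an unlabeled shape together with a
   linear order of A (the list itself, or the leaves from left to right), and
   substitution preserves this: a shape of G ∘ H is a shape of G with a list of
   shapes of H, one for each point.  So structure types are shapes, and an
   isomorphism of species is a size-preserving bijection of shapes.  Cutting a
   painted tree along the paint line yields a base tree and, for each of its
   leaves, a piece whose root is not painted.  A piece is a tree, or a tree with
   at least two leaves whose root is half-painted, that is a shape of 2G - x;
   removing the half-painted root leaves a list of trees, so a piece is also a
   shape of L_+ ∘ G when no order relates the trees of that list.  In the
   weakly ordered case the half-painted root is the lowest level of its piece. *)

Require Import Defs.
From mathcomp Require Import all_boot.
From mathcomp Require Import boolp.

Set Implicit Arguments.
Unset Strict Implicit.
Unset Printing Implicit Defensive.

(** * Species described by shapes and linear orders *)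

(** The obstacle is dependent data: the structure on the nodes of a painted tree has a type
    depending on the tree, and inner structures live on blocks of a partition. Everything is
    therefore flattened to plain data, a tree with a relation on addresses or a list of such, and
    validity becomes a separate predicate. Shapes suffice because two linear orders of equal length
    determine one bijection matching them, so that isomorphism is equality of shapes. The kinds then
    decouple: the base depends only on [D], the pieces only on [C]. To treat them uniformly, lists,
    plane trees and weakly ordered trees all get shapes in [ordered_tree], a list being read as a
    corolla. The delicate point is the weak orders over the base leaves, which come as one relation
    on addresses of the whole tree. It has to be split into one relation per piece and glued back
    without loss; this works because the path between two branches of a painted node meets that
    node. *)

Lemma onth_ltn (T : Type) (s : seq T) i x : onth s i = Some x -> i < size s.
Proof. by move=> e; rewrite -onthTE e. Qed.

Lemma onth_some (T : Type) (s : seq T) i :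
  i < size s -> exists x, onth s i = Some x.
Proof. by rewrite -onthTE; case: onth => // x; exists x. Qed.

Lemma seq_choice (S T : Type) (R : S -> T -> Prop) (s : seq S) :
  (forall i x, onth s i = Some x -> exists y, R x y) ->
  exists2 t : seq T, size t = size s &
    forall i x y, onth s i = Some x -> onth t i = Some y -> R x y.
Proof.
elim: s => [|x s IHs] Rs; first by exists [::] => // -[].
have [y Rxy] := Rs 0 x erefl.
have [t st Rt] := IHs (fun i => Rs i.+1).
by exists (y :: t); rewrite /= ?st // => -[|i] x' y' /=; [case=> <- [<-]|exact: Rt].
Qed.

Lemma uniq_flatten_inj (T : eqType) (ss : seq (seq T)) i j a b x :
  uniq (flatten ss) -> onth ss i = Some a -> onth ss j = Some b ->
  x \in a -> x \in b -> i = j.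
Proof.
elim: ss i j => [|c ss IH] [|i] [|j] //=; rewrite cat_uniq => /and3P[_ nh U].
- move=> [<-] sb xc xb; case/negP: nh; apply/hasP; exists x => //.
  by apply/flattenP; exists b => //; apply/onthP; exists j.
- move=> sa [<-] xa xc; case/negP: nh; apply/hasP; exists x => //.
  by apply/flattenP; exists a => //; apply/onthP; exists i.
- by move=> sa sb xa xb; congr S; exact: (IH i j).
Qed.

Lemma uniq_flatten_onth (T : eqType) (ss : seq (seq T)) i c :
  uniq (flatten ss) -> onth ss i = Some c -> uniq c.
Proof.
elim: ss i => [|d ss IH] [|i] //=; rewrite cat_uniq => /and3P[Ud _ Uss].
  by case=> <-.
exact: IH Uss.
Qed.

Lemma perm_enumP (A : finType) (X : {set A}) (s : seq A) :
  reflect (uniq s /\ s =i X) (perm_eq s (enum X)).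
Proof.
apply: (iffP idP) => [p|[U m]].
  by rewrite (perm_uniq p) enum_uniq; split=> // x; rewrite (perm_mem p) mem_enum.
by apply: uniq_perm; rewrite ?enum_uniq // => x; rewrite m mem_enum.
Qed.

Lemma perm_enumTP (A : finType) (s : seq A) :
  reflect (uniq s /\ forall x, x \in s) (perm_eq s (enum A)).
Proof.
apply: (iffP idP) => [p|[U m]].
  by rewrite (perm_uniq p) enum_uniq; split=> // x; rewrite (perm_mem p) mem_enum.
by apply: uniq_perm; rewrite ?enum_uniq // => x; rewrite m mem_enum.
Qed.

Lemma perm_val_enum (A : finType) (X : {set A}) (s : seq (subfin X)) :
  perm_eq s (enum (subfin X)) -> perm_eq (map val s) (enum X).
Proof.
case/perm_enumTP => U m; apply/perm_enumP; split.
  by rewrite map_inj_uniq //; exact: val_inj.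
move=> x; apply/mapP/idP => [[y _ ->]|xX]; first exact: (valP y).
by exists (exist _ x xX).
Qed.

Lemma perm_enum_lift (A : finType) (X : {set A}) (s : seq A) :
  perm_eq s (enum X) ->
  exists2 s' : seq (subfin X), map val s' = s & perm_eq s' (enum (subfin X)).
Proof.
case/perm_enumP => U m; exists (pmap insub s).
  rewrite (pmap_filter (insubK _)) //; apply/all_filterP/allP => x.
  by rewrite m => xX; rewrite insubT.
apply/perm_enumTP; split=> [|x]; first exact: pmap_sub_uniq.
by rewrite mem_pmap_sub /= m; exact: (valP x).
Qed.

(* The structures of G on A are the pairs of a shape and a linear order of A of
   the right length, naturally in A; an isomorphism class is then a shape. *)
Record shaping (G : species) (T : Type) (V : T -> Prop) (n : T -> nat) : Type :=
  Shaping {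
    shape_of : forall A : finType, G A -> T;
    order_of : forall A : finType, G A -> seq A;
    shape_valid : forall A (s : G A), V (shape_of s);
    order_perm : forall A (s : G A), perm_eq (order_of s) (enum A);
    size_order : forall A (s : G A), size (order_of s) = n (shape_of s);
    shape_natural : forall (A B : finType) (f : A -> B) (fP : bijective f) (s : G A),
      shape_of (transport G fP s) = shape_of s;
    order_natural : forall (A B : finType) (f : A -> B) (fP : bijective f) (s : G A),
      order_of (transport G fP s) = map f (order_of s);
    shaping_inj : forall A (s s' : G A),
      shape_of s = shape_of s' -> order_of s = order_of s' -> s = s';
    shaping_surj : forall (A : finType) t (l : seq A),
      V t -> perm_eq l (enum A) -> size l = n t ->
      exists s : G A, shape_of s = t /\ order_of s = l
  }.

Arguments shaping_inj {G T V n} g {A s s'} : rename.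
Arguments shaping_surj {G T V n} g {A t l} : rename.

(** Shapes can be renamed along a size-preserving bijection of valid shapes, the linear order being
    kept; [phi] may behave arbitrarily on invalid shapes. *)
Lemma shaping_transfer (G : species) (T T' : Type) (V : T -> Prop)
    (V' : T' -> Prop) (n : T -> nat) (n' : T' -> nat) (phi : T -> T') :
  (forall t, V t -> V' (phi t)) ->
  (forall t, V t -> n' (phi t) = n t) ->
  (forall t u, V t -> V u -> phi t = phi u -> t = u) ->
  (forall t', V' t' -> exists2 t, V t & phi t = t') ->
  shaping G V n -> shaping G V' n'.
Proof.
move=> phiV phin phiI phiS [sh od shV odP odn shN odN shI shS].
exists (fun A s => phi (sh A s)) od => //.
- by move=> A s; exact: phiV.
- by move=> A s; rewrite phin.
- by move=> A B f fP s; rewrite shN.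
- by move=> A s s' /(phiI _ _ (shV _ _) (shV _ _)); exact: shI.
move=> A t' l /phiS[t Vt <-] lA; rewrite phin // => lt.
by have [s [<- <-]] := shS A t l Vt lA lt; exists s.
Qed.

(** Each structure is sent to the one with the same shape and the same order. This is natural
    because transport fixes the shape and acts on the order by [map]. *)
Lemma shaping_iso (G H : species) (T : Type) (V : T -> Prop) (n : T -> nat) :
  shaping G V n -> shaping H V n -> species_iso G H.
Proof.
move=> g h.
have gh (A : finType) (s : G A) : {s' : H A |
    shape_of h s' = shape_of g s /\ order_of h s' = order_of g s}.
  apply: cid; apply: shaping_surj; [exact: shape_valid|exact: order_perm|].
  exact: size_order.
have hg (A : finType) (s : H A) : {s' : G A |
    shape_of g s' = shape_of h s /\ order_of g s' = order_of h s}.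
  apply: cid; apply: shaping_surj; [exact: shape_valid|exact: order_perm|].
  exact: size_order.
exists (fun A s => sval (gh A s)); split.
  move=> A; exists (fun s => sval (hg A s)) => s.
    case: (gh A s) => s' /= [e1 e2]; case: (hg A s') => s'' /= [e3 e4].
    by apply: (shaping_inj g); congruence.
  case: (hg A s) => s' /= [e1 e2]; case: (gh A s') => s'' /= [e3 e4].
  by apply: (shaping_inj h); congruence.
move=> A B f fP s.
case: (gh B _) => s1 /= [e1 e2]; case: (gh A s) => s2 /= [e3 e4].
apply: (shaping_inj h).
  by rewrite e1 !shape_natural.
by rewrite e2 !order_natural e4.
Qed.

(** For equal shapes, the bijection is the one matching the two linear orders position by
    position. *)
Lemma isomorphicP (G : species) (T : Type) (V : T -> Prop) (n : T -> nat)
    (g : shaping G V n) (s s' : structure G) :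
  isomorphic s s' <-> shape_of g (projT2 s) = shape_of g (projT2 s').
Proof.
case: s s' => [A s] [B s']; split=> [[f [fP /= <-]]|/= e].
  by rewrite shape_natural.
have /perm_enumTP[Us mA] := order_perm g s.
have /perm_enumTP[Us' mB] := order_perm g s'.
have sz : size (order_of g s) = size (order_of g s') by rewrite !size_order e.
have lA x : index x (order_of g s) < size (order_of g s) by rewrite index_mem.
have lB y : index y (order_of g s') < size (order_of g s') by rewrite index_mem.
(* [nth] needs default elements, so empty carriers are treated apart. *)
case sE : (order_of g s) => [|a0 l].
  have sE' : order_of g s' = [::] by apply: size0nil; rewrite -sz sE.
  have fA (x : A) : False by have := mA x; rewrite sE.
  have fB (x : B) : False by have := mB x; rewrite sE'.
  have fP : bijective (fun x : A => False_rect B (fA x)).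
    by exists (fun y => False_rect A (fB y)) => x; [case: (fA x)|case: (fB x)].
  exists _, fP; apply: (shaping_inj g); first by rewrite shape_natural.
  by rewrite order_natural /= sE sE'.
have [b0 _] : exists b0 : B, true.
  by move: sz; rewrite sE; case: (order_of g s') => // b0; exists b0.
pose f x := nth b0 (order_of g s') (index x (order_of g s)).
pose f' y := nth a0 (order_of g s) (index y (order_of g s')).
have fP : bijective f.
  exists f' => x; rewrite /f /f'.
    by rewrite index_uniq ?nth_index // -sz.
  by rewrite index_uniq ?nth_index // sz.
exists f, fP; apply: (shaping_inj g); first by rewrite shape_natural.
rewrite order_natural /=; apply: (@eq_from_nth _ b0); first by rewrite size_map.
move=> i; rewrite size_map => li.
by rewrite (nth_map a0) // /f index_uniq.
Qed.

(** The class attached to [p] is the set of all structures of shape [b p]; by [isomorphicP] the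
    isomorphism classes are exactly the sets of this form with a valid shape. *)
Lemma types_of_shaping (C D : kind) (G : species) (T : Type) (V : T -> Prop)
    (n : T -> nat) (b : painted_tree C D -> T) :
  shaping G V n -> injective b -> (forall p, V (b p)) ->
  (forall t, V t -> exists p, b p = t) -> (forall p, n (b p) = num_leaves p) ->
  types_of_painted_trees C D G.
Proof.
move=> g bI bV bS bn.
(* A valid shape [t] is realized on the ordinals below [n t] in their usual order, so no class is
   empty. *)
have real t : V t -> exists s : structure G, shape_of g (projT2 s) = t.
  move=> Vt; have := @shaping_surj _ _ _ _ g 'I_(n t) t (enum 'I_(n t)) Vt.
  rewrite perm_refl size_enum_ord => /(_ isT erefl)[s [e _]].
  by exists (existT _ _ s).
have memP p : exists s : structure G,
    (fun s' : structure G => b p = shape_of g (projT2 s')) = isomorphic s.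
  have [s <-] := real _ (bV p); exists s; apply/funext => s'.
  by apply/propext; split=> /isomorphicP.
exists (fun p => StructureType (memP p)); split.
  have inj : injective (fun p => StructureType (memP p)).
    move=> p p' [] e; apply: bI; have [s sp] := real _ (bV p).
    by move/(congr1 (fun Q => Q s)): e; rewrite sp => h; apply: esym; rewrite -h.
  have surj c : exists p, StructureType (memP p) = c.
    case: c => m mP; case: (mP) => s ms.
    have [p bp] := bS _ (shape_valid g (projT2 s)); exists p.
    have e : (fun s' : structure G => b p = shape_of g (projT2 s')) = m.
      by rewrite ms bp; apply/funext => s'; apply/propext; split=> /isomorphicP.
    move: (memP p); rewrite e => q; congr StructureType; exact: Prop_irrelevance.
  pose inv c := sval (cid (surj c)).
  have invK c : StructureType (memP (inv c)) = c by rewrite /inv; case: cid.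
  by exists inv => // p; apply: inj; rewrite invK.
move=> p; have [s sp] := real _ (bV p); exists s; split=> //=.
rewrite -bn -sp -size_order (perm_size (order_perm g (projT2 s))).
by rewrite cardE.
Qed.

Lemma shaping_sum (G H : species) (T U : Type) (V : T -> Prop) (W : U -> Prop)
    (n : T -> nat) (m : U -> nat) :
  shaping G V n -> shaping H W m ->
  shaping (sum_species G H)
    (fun t => match t with inl t => V t | inr u => W u end)
    (fun t => match t with inl t => n t | inr u => m u end).
Proof.
move=> g h.
exists (fun A (s : sum_species G H A) => match s with
                 | inl s => inl (shape_of g s) | inr s => inr (shape_of h s) end)
       (fun A (s : sum_species G H A) => match s with
                 | inl s => order_of g s | inr s => order_of h s end).
- by move=> A [s|s]; exact: shape_valid.
- by move=> A [s|s]; exact: order_perm.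
- by move=> A [s|s]; exact: size_order.
- by move=> A B f fP [s|s] /=; rewrite shape_natural.
- by move=> A B f fP [s|s] /=; rewrite order_natural.
- by move=> A [s|s] [s'|s'] //= [e] e'; rewrite (shaping_inj _ e e').
move=> A [t|t] l Vt lA lt.
  by have [s [<- <-]] := shaping_surj g Vt lA lt; exists (inl s).
by have [s [<- <-]] := shaping_surj h Vt lA lt; exists (inr s).
Qed.

(** The order enumerates the carrier, so the bound on the carrier is a bound on the size of the
    shape. *)
Lemma shaping_ge2 (G : species) (T : Type) (V : T -> Prop) (n : T -> nat) :
  shaping G V n -> shaping (ge2_species G) (fun t => V t /\ 1 < n t) n.
Proof.
move=> g.
have cardn (A : finType) (s : G A) : #|A| = n (shape_of g s).
  by rewrite -size_order (perm_size (order_perm g s)) cardE.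
exists (fun A (s : ge2_species G A) => shape_of g (proj1_sig s))
       (fun A (s : ge2_species G A) => order_of g (proj1_sig s)).
- move=> A [s sA] /=; split; first exact: shape_valid.
  by rewrite -cardn.
- by move=> A s; exact: order_perm.
- by move=> A s; exact: size_order.
- by move=> A B f fP s /=; rewrite shape_natural.
- by move=> A B f fP s /=; rewrite order_natural.
- by move=> A [s p] [s' p'] /= e e'; apply: eq_exist; exact: (shaping_inj g e e').
move=> A t l [Vt nt] lA lt; have [s [st sl]] := shaping_surj g Vt lA lt.
have sA : 1 < #|A| by rewrite (cardn A s) st.
by exists (exist _ s sA).
Qed.

(** * Shapes of a substitution *)

Section ShapingSubst.
Variables (G H : species) (T U : Type) (V : T -> Prop) (W : U -> Prop).
Variables (n : T -> nat) (m : U -> nat).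
Variables (g : shaping G V n) (h : shaping H W m).
(** Blocks of a partition are non-empty, so a shape of [H] of size 0 could not sit on a block. *)
Hypothesis m_gt0 : forall u, W u -> 0 < m u.

Definition subst_valid (p : T * seq U) : Prop :=
  [/\ V p.1, size p.2 = n p.1 & forall i u, onth p.2 i = Some u -> W u].

Definition subst_size (p : T * seq U) : nat := sumn (map m p.2).

Definition subst_shape (A : finType) (s : subst_species G H A) : T * seq U :=
  (shape_of g (outer s),
   [seq shape_of h (inner X) | X <- order_of g (outer s)]).

Definition inner_orders (A : finType) (s : subst_species G H A) : seq (seq A) :=
  [seq map val (order_of h (inner X)) | X <- order_of g (outer s)].

Definition subst_order (A : finType) (s : subst_species G H A) : seq A :=
  flatten (inner_orders s).

Lemma inner_order_block (A : finType) (s : subst_species G H A)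
    (X : subfin (blocks s)) :
  [set x in map val (order_of h (inner X))] = val X.
Proof.
have /perm_enumP[_ e] := perm_val_enum (order_perm h (inner X)).
by apply/setP => x; rewrite inE e.
Qed.

Lemma shape_inner_orders (A : finType) (s : subst_species G H A) :
  shape (inner_orders s) = map m (subst_shape s).2.
Proof.
rewrite /shape /= -!map_comp; apply: eq_map => X /=.
by rewrite size_map size_order.
Qed.

Lemma blocks_order (A : finType) (s : subst_species G H A) :
  map val (order_of g (outer s)) = [seq [set x in c] | c <- inner_orders s].
Proof. by rewrite -map_comp; apply: eq_map => X /=; rewrite inner_order_block. Qed.

(** Every element occurs because the blocks cover [A]. The absence of repetitions is obtained by
    counting: the lengths add up to the sum of the sizes of the blocks, which is [#|A|]. *)
Lemma subst_order_perm (A : finType) (s : subst_species G H A) :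
  perm_eq (subst_order s) (enum A).
Proof.
have sub x : x \in subst_order s.
  have : x \in cover (blocks s) by rewrite (cover_partition (blocksP s)) inE.
  case/bigcupP => X XP xX; apply/flattenP.
  pose X' : subfin (blocks s) := exist _ X XP.
  exists (map val (order_of h (inner X'))).
    apply/mapP; exists X' => //.
    by have /perm_enumTP[_ ->] := order_perm g (outer s).
  by have := inner_order_block X'; move/setP/(_ x); rewrite inE /= xX.
apply/perm_enumTP; split=> //.
apply: (@leq_size_uniq _ (enum A)); rewrite ?enum_uniq // -cardE.
rewrite /subst_order size_flatten.
have -> : shape (inner_orders s) =
    [seq #|X : {set A}| | X : {set A} <- map val (order_of g (outer s))].
  rewrite /shape -!map_comp; apply: eq_map => X /=.
  rewrite size_map (perm_size (order_perm h (inner X))) -cardE.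
  by rewrite card_sig; apply: eq_card.
have p := perm_val_enum (order_perm g (outer s)).
rewrite (perm_sumn (perm_map (fun X : {set A} => #|X|) p)).
rewrite sumnE big_map big_enum /= -(card_partition (blocksP s)).
by rewrite cardsT.
Qed.

(** The inner shapes give the lengths at which to cut the order into inner orders. The set of
    entries of an inner order is its block, so the partition and the order of its blocks are
    recovered too. *)
Lemma subst_shaping_inj (A : finType) (s s' : subst_species G H A) :
  subst_shape s = subst_shape s' -> subst_order s = subst_order s' -> s = s'.
Proof.
move=> sh od.
have eo : inner_orders s = inner_orders s'.
  by apply: eq_from_flatten_shape; rewrite // !shape_inner_orders sh.
have ebl : map val (order_of g (outer s)) = map val (order_of g (outer s')).
  by rewrite !blocks_order eo.
have eb : blocks s = blocks s'.
  apply/setP => X.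
  have /perm_enumP[_ <-] := perm_val_enum (order_perm g (outer s)).
  by have /perm_enumP[_ <-] := perm_val_enum (order_perm g (outer s')); rewrite ebl.
case: s s' eb sh eo ebl {od} => [P pP go hi] [P' pP' go' hi'] /= eb.
subst P'; rewrite /subst_shape /inner_orders /= => -[sh1 sh2] eo ebl.
have ego : go = go'.
  by apply: (shaping_inj g) => //; apply: inj_map ebl; exact: val_inj.
subst go'; have -> : pP' = pP by exact: Prop_irrelevance.
suff -> : hi = hi' by [].
apply: functional_extensionality_dep => X.
have Xo : X \in order_of g go by have /perm_enumTP[_ ->] := order_perm g go.
apply: (shaping_inj h); first by move/eq_in_map: sh2; exact.
by move/eq_in_map: eo => /(_ X Xo); apply: inj_map; exact: val_inj.
Qed.

Lemma subst_shaping_surj (A : finType) (p : T * seq U) (l : seq A) :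
  subst_valid p -> perm_eq l (enum A) -> size l = subst_size p ->
  exists s : subst_species G H A, subst_shape s = p /\ subst_order s = l.
Proof.
case: p => t us [/= Vt st Wus] /perm_enumTP[Ul ml] sl; rewrite /subst_size /= in sl.
(* The cut prescribed by the sizes of the inner shapes; the blocks will be the sets of entries of
   the segments, distinct because the segments are disjoint and non-empty. *)
pose ss := reshape (map m us) l.
have fl : flatten ss = l by rewrite reshapeKr // sl.
have shp : shape ss = map m us by rewrite reshapeKl // sl.
have szs : size ss = size us by rewrite -(size_map size) -/(shape ss) shp size_map.
have Uf : uniq (flatten ss) by rewrite fl.
have ss_us i c : onth ss i = Some c ->
    exists2 u, onth us i = Some u & W u /\ size c = m u.
  move=> e; have [|u ui] := @onth_some _ us i; first by rewrite -szs; exact: onth_ltn e.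
  exists u => //; split; first exact: Wus ui.
  have : onth (shape ss) i = onth (map m us) i by rewrite shp.
  by rewrite /shape !onth_map e ui => -[].
have ss_ne i c : onth ss i = Some c -> exists x, x \in c.
  move=> /ss_us[u _ [Wu cu]]; have := m_gt0 Wu; rewrite -cu.
  by case: c {cu} => // x c _; exists x; rewrite mem_head.
pose bs := [seq [set x in c] | c <- ss].
have bsP i X : onth bs i = Some X -> exists2 c, onth ss i = Some c & X = [set x in c].
  by rewrite onth_map; case: onth => // c [<-]; exists c.
have bs_inj i j X Y x : onth bs i = Some X -> onth bs j = Some Y ->
    x \in X -> x \in Y -> i = j.
  move=> /bsP[c ci ->] /bsP[d dj ->]; rewrite !inE.
  exact: uniq_flatten_inj Uf ci dj.
have bs_ne i X : onth bs i = Some X -> exists x, x \in X.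
  by move=> /bsP[c /ss_ne[x xc] ->]; exists x; rewrite inE.
have Ubs : uniq bs.
  apply/(uniqP set0) => i j; rewrite !inE => li lj e.
  have [X bi] := onth_some li; have [Y bj] := onth_some lj.
  have [x xX] := bs_ne _ _ bi; apply: (bs_inj _ _ _ _ x bi bj xX).
  by move: e; rewrite (onth_nth _ _ _ _ bi) (onth_nth _ _ _ _ bj) => <-.
pose P := [set X in bs].
have pP : partition P [set: A].
  apply/and3P; split.
  - apply/eqP/setP => x; rewrite inE; apply/bigcupP.
    have := ml x; rewrite -fl => /flattenP[c cs xc].
    by exists [set y in c]; rewrite inE //; apply: map_f.
  - apply/trivIsetP => X Y; rewrite !inE => /onthP[i bi] /onthP[j bj] /eqP XY.
    apply/pred0P => x /=; apply/negP => /andP[xX xY]; case: XY.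
    by have := bj; rewrite -(bs_inj _ _ _ _ _ bi bj xX xY) bi => -[].
  - rewrite inE; apply/onthP => -[i /bs_ne[x]].
    by rewrite inE.
have [bo bov bop] : exists2 bo : seq (subfin P), map val bo = bs &
    perm_eq bo (enum (subfin P)).
  by apply: perm_enum_lift; apply/perm_enumP; split=> // X; rewrite inE.
have [go [gsh god]] : exists s : G (subfin P), shape_of g s = t /\ order_of g s = bo.
  apply: shaping_surj => //.
  by rewrite -(size_map val) bov size_map szs.
(* The inner structure on [X] is specified at every position [i] of [X] in [bs]. That position is
   unique by [bs_inj], so one choice meets the whole specification. *)
have hi (X : subfin P) : {s : H (subfin (val X)) |
    forall i, onth bs i = Some (val X) ->
      onth us i = Some (shape_of h s) /\
      onth ss i = Some (map val (order_of h s))}.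
  apply: cid; case: X => X /= XP.
  have /onthP[i bi] : X \in bs by rewrite inE in XP.
  have [c ci cX] := bsP _ _ bi; have [u ui [Wu cu]] := ss_us _ _ ci.
  have [|c' c'c pc'] := @perm_enum_lift A X c.
    apply/perm_enumP; split=> [|x]; last by rewrite cX inE.
    exact: uniq_flatten_onth Uf ci.
  have [s [sh od]] := shaping_surj h Wu pc' (etrans (esym (size_map val _))
    (etrans (congr1 size c'c) cu)).
  exists s => j bj; have [x xX] := bs_ne _ _ bi.
  by rewrite (bs_inj _ _ _ _ _ bj bi xX xX) sh od c'c.
exists (@SubstStructure G H A P pP go (fun X => sval (hi X))).
have boP i X : onth bo i = Some X -> onth bs i = Some (val X).
  by move=> bi; rewrite -bov onth_map bi.
have sbo : size bo = size ss by rewrite -(size_map val) bov size_map.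
rewrite /subst_shape /subst_order /inner_orders /= gsh god; split.
  congr pair; apply: eq_from_onth => i; rewrite onth_map.
  case bi: (onth bo i) => [X|] /=.
    by case: (hi X) => s /= /(_ i (boP _ _ bi))[->].
  by apply/esym/onth_default; rewrite -szs -sbo -onthNE bi.
rewrite -[RHS]fl; congr flatten; apply: eq_from_onth => i; rewrite onth_map.
case bi: (onth bo i) => [X|] /=.
  by case: (hi X) => s /= /(_ i (boP _ _ bi))[_ ->].
by apply/esym/onth_default; rewrite -sbo -onthNE bi.
Qed.

Lemma preimage_block_image (A B : finType) (f : A -> B) (fP : bijective f)
    (s : subst_species G H A) (X : subfin (blocks s)) :
  preimage_block fP (restrict (mem_image_blocks fP (blocks s)) X) = X.
Proof.
apply: val_inj; apply/setP => x; rewrite /= inE mem_imset //.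
exact: (bij_inj fP).
Qed.

Lemma shaping_subst : shaping (subst_species G H) subst_valid subst_size.
Proof.
exists subst_shape subst_order.
- move=> A s; split=> /=; first exact: shape_valid.
    by rewrite size_map size_order.
  by move=> i u; rewrite onth_map; case: onth => // X [<-]; exact: shape_valid.
- exact: subst_order_perm.
- by move=> A s; rewrite /subst_order size_flatten shape_inner_orders.
- move=> A B f fP s; rewrite /subst_shape /= shape_natural order_natural.
  rewrite -map_comp; congr pair; apply: eq_map => X /=.
  rewrite shape_natural.
  (* The type of [inner X] depends on [X], so the equality of blocks is applied through a function
     with values in [U]. *)
  exact: (congr1 (fun X => shape_of h (inner X)) (preimage_block_image fP X)).
- move=> A B f fP s; rewrite /subst_order /inner_orders /= order_natural.
  rewrite map_flatten -!map_comp; congr flatten; apply: eq_map => X /=.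
  rewrite order_natural -!map_comp.
  exact: (congr1 (fun X => [seq f (val x) | x <- order_of h (inner X)])
                 (preimage_block_image fP X)).
- exact: subst_shaping_inj.
- exact: subst_shaping_surj.
Qed.

End ShapingSubst.

(** * Shapes of lists, plane trees and weakly ordered trees *)

Lemma tree_onth_ind (L N : Type) (P : tree L N -> Prop) :
  (forall l, P (Leaf N l)) ->
  (forall c ts, (forall i t, onth ts i = Some t -> P t) -> P (Node c ts)) ->
  forall t, P t.
Proof.
move=> PL PN; apply: tree_rect_all => // c ts IH; apply: PN.
by elim: ts IH => [|t ts IHts] /= IH [|i] //= u; case: IH => Pt Pts; [case=> <-|exact: IHts].
Qed.

Definition forget_leaves (L N : Type) : tree L N -> tree unit N :=
  map_leaves (fun=> tt).

Definition bare (L N : Type) (t : tree L N) : bool := if t is Leaf _ then true else false.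

Lemma all_onthP (T : Type) (p : pred T) (s : seq T) :
  all p s <-> forall i x, onth s i = Some x -> p x.
Proof.
elim: s => [|x s IH] /=; first by split=> // _ [].
split=> [/andP[px /IH ps] [|i] y /=|ps].
- by case=> <-.
- exact: ps.
- by rewrite (ps 0 x erefl) //=; apply/IH => i; exact: (ps i.+1).
Qed.

Lemma leaves_gt0 (L N : Type) (t : tree L N) : plane_tree t -> 0 < size (leaves t).
Proof.
elim/tree_onth_ind: t => [l|c [|t ts] IH] //= /and3P[_ pt _].
by rewrite size_cat ltn_addr // (IH 0).
Qed.

Lemma leaves_gt1 (L N : Type) (t : tree L N) :
  plane_tree t -> (1 < size (leaves t)) = ~~ bare t.
Proof.
case: t => [l|c [|t [|u ts]]] //= /and3P[pt pu _].
by rewrite !size_cat (leq_add (leaves_gt0 pt)) // ltn_addr // leaves_gt0.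
Qed.

Lemma cat_inj_size (T : Type) (a b c d : seq T) :
  a ++ b = c ++ d -> size a = size c -> a = c /\ b = d.
Proof.
move=> e s; split.
  by have := congr1 (take (size a)) e; rewrite take_size_cat // s take_size_cat.
by have := congr1 (drop (size a)) e; rewrite drop_size_cat // s drop_size_cat.
Qed.

(** The unlabeled tree tells how many labels each subtree takes, hence where to cut the word of
    labels. *)
Lemma forget_leaves_inj (L N : Type) (t t' : tree L N) :
  forget_leaves t = forget_leaves t' -> leaves t = leaves t' -> t = t'.
Proof.
rewrite /forget_leaves.
have sz (u u' : tree L N) : map_leaves (fun=> tt) u = map_leaves (fun=> tt) u' ->
    size (leaves u) = size (leaves u').
  by move/(congr1 (@leaves _ _)); rewrite !leaves_map => /(congr1 size); rewrite !size_map.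
elim/tree_rect_all: t t' => [l|c ts IH] [l'|c' ts'] //=; first by move=> _ [->].
case=> <- e fl; congr Node.
elim: ts IH ts' e fl => [|t ts IHts] /= IH [|t' ts'] //=.
case: IH => IHt /IHts {}IHts [et ets] /cat_inj_size/(_ (sz _ _ et))[e1 e2].
by rewrite (IHt t') // (IHts ts').
Qed.

Lemma forget_leaves_surj (L N : Type) (u : tree unit N) (l : seq L) :
  size l = size (leaves u) -> exists2 t, forget_leaves t = u & leaves t = l.
Proof.
rewrite /forget_leaves.
elim/tree_rect_all: u l => [[]|c us IH] l /=.
  by case: l => [|x []] // _; exists (Leaf N x).
move=> sl; suff [ts <- <-] : exists2 ts : seq (tree L N),
    map (map_leaves (fun=> tt)) ts = us & flatten (map (@leaves _ _) ts) = l.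
  by exists (Node c ts).
elim: us IH l sl => [|u us IHus] /= IH l; first by move/size0nil->; exists [::].
case: IH => IHu /IHus {}IHus; rewrite size_cat => sl.
have [|t tu tl] := IHu (take (size (leaves u)) l).
  by rewrite size_takel // sl leq_addr.
have [|ts tsu tsl] := IHus (drop (size (leaves u)) l).
  by rewrite size_drop sl addKn.
exists (t :: ts) => /=; first by rewrite tu tsu.
by rewrite tl tsl cat_take_drop.
Qed.

Lemma size_forget_leaves (L N : Type) (t : tree L N) :
  size (leaves (forget_leaves t)) = size (leaves t).
Proof. by rewrite leaves_map size_map. Qed.

Definition no_rel : rel address := fun _ _ => false.

(* A structure of kind D on the set S of nodes is always recorded as a relation,
   namely no_rel when D requires no order. *)
Definition order_on (D : kind) (S : address -> Prop) (r : rel address) : Prop :=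
  match D with
  | Corollas => (forall v w, S v -> S w -> v = w) /\ r = no_rel
  | PlaneTrees => r = no_rel
  | WeaklyOrderedTrees => weak_order (fun v w => S v /\ S w) r
  end.

Definition ordered_tree : Type := (tree unit unit * rel address)%type.

Definition ordered_tree_valid (D : kind) (p : ordered_tree) : Prop :=
  plane_tree p.1 /\ order_on D (is_node p.1) p.2.

Definition ordered_tree_size (p : ordered_tree) : nat := size (leaves p.1).

(** The shape of a list of length [k]. For [k = 1] it is the one-leaf tree, a node having at least
    two inputs. *)
Definition corolla (k : nat) : ordered_tree :=
  (if k == 1 then Leaf unit tt else Node tt (nseq k (Leaf unit tt)), no_rel).

Lemma corolla_size k : ordered_tree_size (corolla k) = k.
Proof.
rewrite /ordered_tree_size /=; case: eqP => [->|_] //=.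
by elim: k => //= k ->.
Qed.

Lemma is_nodeE (L N : Type) (t : tree L N) v :
  is_node t v = if subtree t v is Some u then ~~ bare u else false.
Proof. by rewrite /is_node /decoration; case: subtree => // -[]. Qed.

Lemma is_node_nil (L N : Type) (t : tree L N) : is_node t [::] = ~~ bare t.
Proof. by rewrite is_nodeE. Qed.

Lemma is_node_cons (L N : Type) (c : N) (ts : seq (tree L N)) i v :
  is_node (Node c ts) (i :: v) = if onth ts i is Some u then is_node u v else false.
Proof. by rewrite is_nodeE /=; case: onth => // u; rewrite is_nodeE. Qed.

Lemma bareE (t : tree unit unit) : bare t -> t = Leaf unit tt.
Proof. by case: t => [[]|]. Qed.

Lemma corolla_valid k : 0 < k -> ordered_tree_valid Corollas (corolla k).
Proof.
move=> k_gt0; split=> /=.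
  case: eqP => //= /eqP k1; rewrite size_nseq.
  have -> : 1 < k by case: k k_gt0 k1 => [|[]].
  by elim: k {k_gt0 k1} => //= k ->.
split=> //; case: eqP => _.
  by case=> [|i v] w; rewrite is_nodeE.
have nd v : is_node (Node tt (nseq k (Leaf unit tt))) v -> v = [::].
  case: v => // i v; rewrite is_node_cons onth_nseq.
  by case: ltnP => // _; case: v.
by move=> v w /nd -> /nd ->.
Qed.

(** If the root is a node, an input that is not a leaf would be a second node. *)
Lemma valid_corolla (p : ordered_tree) :
  ordered_tree_valid Corollas p -> p = corolla (ordered_tree_size p).
Proof.
case: p => u r [/= pu [uniq_node ->]]; congr pair; rewrite /ordered_tree_size /=.
case: u pu uniq_node => [[]|[] ts] //= /andP[s2 _] un.
have e : ts = nseq (size ts) (Leaf unit tt).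
  apply: eq_from_onth => i; rewrite onth_nseq; case: ltnP => li; last first.
    exact: onth_default.
  have [u ui] := onth_some li; rewrite ui; congr Some; apply: bareE.
  apply/negPn/negP => nu; have := un [::] [:: i].
  by rewrite is_node_nil is_node_cons ui is_node_nil => /(_ isT nu).
have -> : size (flatten [seq leaves u | u <- ts]) = size ts.
  by rewrite e size_nseq; elim: (size ts) => //= k ->.
by rewrite gtn_eqF // -e.
Qed.

Lemma shaping_L_plus :
  shaping L_plus (ordered_tree_valid Corollas) ordered_tree_size.
Proof.
exists (fun A (s : L_plus A) => corolla (size (proj1_sig s)))
       (fun A (s : L_plus A) => proj1_sig s).
- move=> A [s /= /andP[s0 _]]; apply: corolla_valid.
  by case: s s0.
- by move=> A [s /= /andP[]].
- by move=> A s; rewrite corolla_size.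
- by move=> A B f fP s /=; rewrite size_map.
- by [].
- by move=> A [s p] [s' p'] /= _ e; apply: eq_exist.
move=> A t l /[dup] tV /valid_corolla tE lA sl.
have l0 : (l != [::]) && perm_eq l (enum A).
  rewrite lA andbT -size_eq0 -lt0n sl; apply: leaves_gt0; exact: (proj1 tV).
by exists (exist _ l l0); rewrite /= sl -tE.
Qed.

Lemma plane_forget (L N : Type) (t : tree L N) :
  plane_tree (forget_leaves t) = plane_tree t.
Proof. exact: plane_tree_map. Qed.

Lemma is_node_forget (L N : Type) (t : tree L N) :
  is_node (forget_leaves t) = is_node t.
Proof. by apply: funext => v; exact: is_node_map. Qed.

Lemma shaping_Y : shaping Y (ordered_tree_valid PlaneTrees) ordered_tree_size.
Proof.
exists (fun A (s : Y A) => (forget_leaves (proj1_sig s), no_rel))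
       (fun A (s : Y A) => leaves (proj1_sig s)).
- by move=> A [t /= /andP[pt _]]; split; rewrite //= plane_forget.
- by move=> A [t /= /andP[]].
- by move=> A s; rewrite /ordered_tree_size size_forget_leaves.
- by move=> A B f fP [s p] /=; rewrite /forget_leaves -map_leaves_comp.
- by move=> A B f fP [s p] /=; rewrite leaves_map.
- by move=> A [s p] [s' p'] /= [e] e'; apply: eq_exist; exact: forget_leaves_inj.
move=> A [u r] l [/= pu ->] lA sl.
have [t tu tl] := forget_leaves_surj sl.
have tA : labeled_by t by rewrite /labeled_by tl lA -plane_forget tu pu.
by exists (exist _ t tA); rewrite /= tu.
Qed.

Lemma shaping_F :
  shaping F (ordered_tree_valid WeaklyOrderedTrees) ordered_tree_size.
Proof.
exists (fun A (s : F A) => (forget_leaves (wo_tree s), wo_rel s))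
       (fun A (s : F A) => leaves (wo_tree s)).
- move=> A [t r /= /andP[pt _] rP]; split; rewrite /= ?plane_forget //.
  by rewrite is_node_forget.
- by move=> A [t r /= /andP[]].
- by move=> A s; rewrite /ordered_tree_size size_forget_leaves.
- by move=> A B f fP [s r p q] /=; rewrite /forget_leaves -map_leaves_comp.
- by move=> A B f fP [s r p q] /=; rewrite leaves_map.
- move=> A s s' [e er] e'; apply: weakly_ordered_eq => //.
  exact: forget_leaves_inj.
move=> A [u r] l [/= pu rP] lA sl.
have [t tu tl] := forget_leaves_surj sl.
have tA : labeled_by t by rewrite /labeled_by tl lA -plane_forget tu pu.
have tr : node_weak_order t r by rewrite /node_weak_order -is_node_forget tu.
by exists (WeaklyOrdered tA tr); rewrite /= tu.
Qed.

(** * Cutting a painted tree along the paint line *)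

(** In [pieces] the recursive calls go through an ordinary [map], which the guard condition accepts;
    [mapi] then hands each resulting function the share of the relation belonging to its branch. *)
Fixpoint mapi (S T : Type) (f : nat -> S -> T) (s : seq S) : seq T :=
  if s is x :: s' then f 0 x :: mapi (fun i => f i.+1) s' else [::].

Lemma onth_mapi (S T : Type) (f : nat -> S -> T) (s : seq S) i :
  onth (mapi f s) i = omap (f i) (onth s i).
Proof. by elim: s f i => [|x s IH] f [|i] /=; rewrite ?IH. Qed.

Lemma size_mapi (S T : Type) (f : nat -> S -> T) (s : seq S) :
  size (mapi f s) = size s.
Proof. by elim: s f => //= x s IH f; rewrite IH. Qed.

Lemma all_flatten (T : Type) (p : pred T) (ss : seq (seq T)) :
  all p (flatten ss) = all (all p) ss.
Proof. by elim: ss => //= s ss IH; rewrite all_cat IH. Qed.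

Lemma decoration_cons (L N : Type) (c : N) (ts : seq (tree L N)) i v :
  decoration (Node c ts) (i :: v) =
  if onth ts i is Some u then decoration u v else None.
Proof. by rewrite /decoration /=; case: onth. Qed.

Lemma strictly_above_cons i j v w :
  strictly_above (i :: w) (j :: v) = (i == j) && strictly_above w v.
Proof.
by rewrite /strictly_above /= eqseq_cons (eq_sym j); case: eqP => //= ->; rewrite eqxx.
Qed.

Lemma strictly_above_nil w : strictly_above w [::] = (w != [::]).
Proof. by case: w. Qed.

Lemma strictly_above_nilP v : strictly_above [::] v = false.
Proof. by case: v. Qed.

(** The condition on pairs of nodes becomes recursive: comparable nodes lie in a common branch
    unless the lower one is the root, and a painted root imposes nothing. *)
Lemma painting_node (c : paint) (ts : seq (tree unit paint)) :
  painting (Node c ts) <->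
  (forall i u, onth ts i = Some u -> painting u) /\
  (c <> Painted -> forall i u v, onth ts i = Some u -> is_node u v ->
     node_unpainted u v).
Proof.
split=> [pt|[pts cts]].
  split=> [i u ui v w nv nw wv dv|cP i u v ui nv].
    have := pt (i :: v) (i :: w); rewrite !is_node_cons !decoration_cons ui.
    by rewrite strictly_above_cons eqxx; exact.
  have := pt [::] (i :: v); rewrite is_node_cons decoration_cons ui; apply=> //.
  by case: c cP {pt} => // _; [left|right].
case=> [|i v] [|j w]; rewrite ?strictly_above_nilP //.
  rewrite is_node_cons decoration_cons; case uj: (onth ts j) => [u|] //.
  move=> _ nw _ cd; apply: cts uj nw => cP.
  by rewrite cP in cd; case: cd.
rewrite strictly_above_cons; case: eqP => //= <-.
rewrite !is_node_cons !decoration_cons; case ui: (onth ts j) => [u|] //.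
exact: pts ui v w.
Qed.

Lemma unpainted_cons (c : paint) (ts : seq (tree unit paint)) i v :
  node_unpainted (Node c ts) (i :: v) <->
  exists2 u, onth ts i = Some u & node_unpainted u v.
Proof.
rewrite /node_unpainted decoration_cons; case: onth => [u|]; split=> //.
- by move=> uv; exists u.
- by case=> _ [<-].
- by case.
Qed.

Lemma unpainted_root (c : paint) (ts : seq (tree unit paint)) :
  node_unpainted (Node c ts) [::] -> c = Unpainted.
Proof. by rewrite /node_unpainted /decoration /= => -[]. Qed.

Definition same_forest (t : tree unit paint) (v w : address) : Prop :=
  [/\ node_unpainted t v, node_unpainted t w & same_base_leaf t v w].

(** The analogue of [order_on] for unpainted nodes. Here [Corollas] forbids only comparable nodes:
    distinct branches may each contain an unpainted node. *)
Definition forest_on (C : kind) (t : tree unit paint) (r : rel address) : Prop :=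
  match C with
  | Corollas => (forall v w, node_unpainted t v -> node_unpainted t w ->
                  ~ strictly_above w v) /\ r = no_rel
  | PlaneTrees => r = no_rel
  | WeaklyOrderedTrees => weak_order (same_forest t) r
  end.

Definition forest_tree : Type := (tree unit paint * rel address)%type.

Definition forest_valid (C : kind) (p : forest_tree) : Prop :=
  [/\ plane_tree p.1, painting p.1 & forest_on C p.1 p.2].

Definition painted_root (t : tree unit paint) : bool :=
  if t is Node Painted _ then true else false.

Definition piece_valid (C : kind) (p : forest_tree) : Prop :=
  ~~ painted_root p.1 /\ forest_valid C p.

Definition piece_size (p : forest_tree) : nat := size (leaves p.1).

Definition shift (i : nat) (r : rel address) : rel address :=
  fun v w => r (i :: v) (i :: w).

(* The base tree, each leaf of which carries the piece grafted there with its
   share of r, re-addressed from the root of the piece. *)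
Fixpoint pieces (t : tree unit paint) (r : rel address) : tree forest_tree unit :=
  match t with
  | Node Painted ts =>
      Node tt (mapi (fun i d => d (shift i r)) (map pieces ts))
  | _ => Leaf unit (t, r)
  end.

Lemma pieces_unpainted t r : ~~ painted_root t -> pieces t r = Leaf unit (t, r).
Proof. by case: t => [[]|[] ts]. Qed.

(** The path between nodes of two different branches passes through the root, which is painted.
    Inside one branch [i], the address [[:: i]] is a common prefix, so the path avoids the root. *)
Lemma same_forest_painted (ts : seq (tree unit paint)) v w :
  same_forest (Node Painted ts) v w <->
  exists i u v' w', [/\ v = i :: v', w = i :: w', onth ts i = Some u &
                        same_forest u v' w'].
Proof.
split=> [[]|[i [u [v' [w' [-> -> ui [nv nw vw]]]]]]].
  case: v => [/unpainted_root//|i v]; case: w => [_ /unpainted_root//|j w].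
  move=> /unpainted_cons[u ui nv] /unpainted_cons[u' uj nw] vw.
  have ij : i = j.
    apply/eqP/negPn/negP => ij; apply: (vw [::]) => //; split=> // -[|k x] //=.
    by case/andP=> /eqP-> _ /andP[ij']; rewrite ij' in ij.
  subst j; exists i, u, v, w; split=> //; split=> //.
    by move: uj; rewrite ui => -[->].
  move=> x [xvw xp]; have := vw (i :: x); rewrite /node_painted decoration_cons ui.
  apply; split; first by rewrite /= eqxx.
  by case=> // k y /=; case: eqP => // _; exact: xp.
split; [by apply/unpainted_cons; exists u..|].
move=> [|k x] [xvw xp].
  by have := xp [:: i]; rewrite /= !eqxx !prefix0s => /(_ isT isT).
have /= := xp [:: i]; rewrite /= eqxx !prefix0s => /(_ isT isT) /andP[/eqP ik _].
subst k; rewrite /node_painted decoration_cons ui; apply: vw; split.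
  by move: xvw; rewrite /= eqxx.
by move=> y yv yw; have := xp (i :: y); rewrite /= eqxx; exact.
Qed.

(** * Splitting relations along the branches of a painted node *)

Definition branchwise (k : nat) (r : rel address) : Prop :=
  forall v w, r v w ->
    exists i v' w', [/\ v = i :: v', w = i :: w' & i < k].

(** A branchwise relation is the disjoint union of its shifts. *)
Lemma branchwise_ext (k : nat) (r r' : rel address) :
  branchwise k r -> branchwise k r' ->
  (forall i, i < k -> shift i r = shift i r') -> r = r'.
Proof.
move=> br br' e; apply/funext => v; apply/funext => w; apply/idP/idP.
  move=> /[dup] h /br[i [v' [w' [vE wE ik]]]]; subst v w.
  by have := congr1 (fun r => r v' w') (e i ik); rewrite /shift => <-.
move=> /[dup] h /br'[i [v' [w' [vE wE ik]]]]; subst v w.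
by have := congr1 (fun r => r v' w') (e i ik); rewrite /shift => ->.
Qed.

(** Since [E] never relates two branches, a weak order along [E] is an independent choice of a weak
    order in each branch. Iterated down to the paint line, this trades one relation on the whole
    tree for one relation per piece. *)
Lemma weak_order_branches (E : address -> address -> Prop)
    (E' : nat -> address -> address -> Prop) (k : nat) (r : rel address) :
  (forall v w, E v w <-> exists i v' w',
     [/\ v = i :: v', w = i :: w', i < k & E' i v' w']) ->
  weak_order E r <->
  branchwise k r /\ forall i, i < k -> weak_order (E' i) (shift i r).
Proof.
move=> EP; split=> [[rE rT rC rA]|[br rW]].
  split=> [v w /rE/EP[i [v' [w' []]]]|i ik]; first by exists i, v', w'.
  split.
  - move=> v w /rE/EP[j [v' [w' [[? ?] [? ?] _ e]]]]; subst; exact: e.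
  - by move=> v w e; apply: rT; apply/EP; exists i, v, w.
  - by move=> v w x; exact: rC.
  - move=> v w e wv; apply: rA; last by rewrite strictly_above_cons eqxx.
    by apply/EP; exists i, v, w.
split.
- move=> v w /[dup] h /br[i [v' [w' [vE wE ik]]]]; subst v w.
  apply/EP; exists i, v', w'; split=> //; case: (rW i ik) => rE _ _ _.
  exact: rE.
- by move=> v w /EP[i [v' [w' [-> -> ik e]]]]; case: (rW i ik) => _ rT _ _; exact: rT.
- move=> v w x /[dup] h /br[i [v' [w' [vE wE ik]]]]; subst v w.
  move=> /[dup] h' /br[j [v'' [w'' [[? ?] wE jk]]]]; subst.
  by case: (rW _ ik) => _ _ rC _; exact: (rC v'').
- move=> v w /EP[i [v' [w' [-> -> ik e]]]].
  by rewrite strictly_above_cons eqxx; case: (rW i ik) => _ _ _ rA; exact: rA.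
Qed.

Lemma forest_on_painted (C : kind) (ts : seq (tree unit paint)) r :
  forest_on C (Node Painted ts) r <->
  branchwise (size ts) r /\
  forall i u, onth ts i = Some u -> forest_on C u (shift i r).
Proof.
case: C => /=.
- split=> [[ts_c ->]|[br ts_c]].
    split=> // i u ui; split=> // v w nv nw wv.
    have /ts_c : node_unpainted (Node Painted ts) (i :: v).
      by apply/unpainted_cons; exists u.
    move=> /(_ (i :: w)); rewrite strictly_above_cons eqxx; apply=> //.
    by apply/unpainted_cons; exists u.
  split; last first.
    apply: (branchwise_ext br) => // i /onth_some[u ui].
    by case: (ts_c i u ui) => _ ->.
  case=> [|i v] [|j w]; rewrite ?strictly_above_nilP //; try by move/unpainted_root.
  move=> /unpainted_cons[u ui nv] /unpainted_cons[u' uj nw].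
  rewrite strictly_above_cons; case: eqP => // ij; subst j.
  by move: uj; rewrite ui => -[uu]; subst u'; case: (ts_c i u ui) => + _; apply.
- split=> [->|[br ts_c]]; first by split.
  apply: (branchwise_ext br) => // i /onth_some[u ui].
  by rewrite (ts_c i u ui).
pose E' i v w := if onth ts i is Some u then same_forest u v w else False.
rewrite (@weak_order_branches _ E' (size ts)); last first.
  move=> v w; rewrite same_forest_painted; split.
    move=> [i [u [v' [w' [-> -> ui e]]]]]; exists i, v', w'.
    by rewrite (onth_ltn ui) /E' ui.
  move=> [i [v' [w' [-> -> /onth_some[u ui]]]]]; rewrite /E' ui => e.
  by exists i, u, v', w'.
split=> -[br h]; split=> // i.
  by move=> u ui; have := h i (onth_ltn ui); rewrite /E' ui.
by move=> /onth_some[u ui]; rewrite /E' ui; exact: h.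
Qed.

Lemma forest_valid_painted (C : kind) (ts : seq (tree unit paint)) r :
  forest_valid C (Node Painted ts, r) <->
  [/\ 1 < size ts, branchwise (size ts) r &
      forall i u, onth ts i = Some u -> forest_valid C (u, shift i r)].
Proof.
rewrite /forest_valid /=; split.
  move=> [/andP[s1 /all_onthP pts] /painting_node[pt _] /forest_on_painted[br f]].
  by split=> // i u ui; split; [exact: pts ui|exact: pt ui|exact: f].
move=> [s1 br h]; split.
- by rewrite s1; apply/all_onthP => i u /h[].
- by apply/painting_node; split=> // i u /h[].
- by apply/forest_on_painted; split=> // i u /h[].
Qed.

Lemma onth_pieces ts r i u : onth ts i = Some u ->
  onth (mapi (fun i d => d (shift i r)) (map pieces ts)) i =
    Some (pieces u (shift i r)).
Proof. by move=> ui; rewrite onth_mapi onth_map ui. Qed.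

(** At a painted node [pieces] keeps only the shifts of [r]. Validity makes [r] branchwise there, so
    the shifts determine it. *)
Lemma pieces_inj (C : kind) t r t' r' :
  forest_valid C (t, r) -> forest_valid C (t', r') ->
  pieces t r = pieces t' r' -> (t, r) = (t', r').
Proof.
elim/tree_onth_ind: t r t' r' => [l|c ts IH] r t' r'.
  by move=> _ _; case: t' => [l'|[] ts'] //= [<- <-].
case: c; try by move=> _ _; case: t' => [l'|[] ts'] //= [<- <-].
case: t' => [l'|[] ts'] //.
move=> /forest_valid_painted[_ br ok] /forest_valid_painted[_ br' ok'] /= [e].
have sz : size ts = size ts'.
  by move/(congr1 size): e; rewrite !size_mapi !size_map.
have rec i u u' : onth ts i = Some u -> onth ts' i = Some u' ->
    (u, shift i r) = (u', shift i r').
  move=> ui ui'; apply: (IH i u ui); [exact: ok|exact: ok'|].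
  move/(congr1 (fun s => onth s i)): e.
  by rewrite (onth_pieces _ ui) (onth_pieces _ ui') => -[].
have ets : ts = ts'.
  apply: eq_from_onth_le => i; rewrite -sz maxnn => li.
  have [u ui] := onth_some li; have [|u' ui'] := @onth_some _ ts' i; first by rewrite -sz.
  by rewrite ui ui'; have [-> _] := rec i u u' ui ui'.
congr pair; first by rewrite ets.
rewrite -sz in br'; apply: (branchwise_ext br br') => i li.
have [u ui] := onth_some li; have ui' := ui; rewrite ets in ui'.
by have [] := rec i u u ui ui'.
Qed.

Lemma pieces_surj (C : kind) (b : tree forest_tree unit) :
  plane_tree b -> all (fun p => `[< piece_valid C p >]) (leaves b) ->
  exists2 p, forest_valid C p & pieces p.1 p.2 = b.
Proof.
elim/tree_onth_ind: b => [[t r]|[] bs IH] /=.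
  by move=> _ /andP[/asboolP[/= rt vt] _]; exists (t, r); rewrite ?pieces_unpainted.
move=> /andP[s1 /all_onthP pbs]; rewrite all_flatten => /all_onthP vbs.
have [|ps sps Rps] :=
    @seq_choice _ _ (fun b p => forest_valid C p /\ pieces p.1 p.2 = b) bs.
  move=> i b bi; have [||p pv pb] := IH i b bi; [exact: pbs bi| |by exists p].
  by apply: (vbs i); rewrite onth_map bi.
(* The relations of the branches are glued: addresses in different branches are unrelated, as are
   those outside of all branches. *)
pose r : rel address := fun v w =>
  match v, w with
  | i :: v', j :: w' => (i == j) && (if onth ps i is Some p then p.2 v' w' else false)
  | _, _ => false
  end.
have rP i p : onth ps i = Some p -> shift i r = p.2.
  move=> pi; apply/funext => v; apply/funext => w.
  by rewrite /shift /r eqxx pi.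
exists (Node Painted (map fst ps), r).
  apply/forest_valid_painted; rewrite size_map sps; split=> //.
    move=> [|i v] [|j w] //= /andP[/eqP <-].
    case pi: (onth ps i) => [p|] // _; exists i, v, w; split=> //.
    by rewrite -sps; exact: onth_ltn pi.
  move=> i u; rewrite onth_map; case pi: (onth ps i) => [p|] //= [<-].
  have [b bi] : exists b, onth bs i = Some b.
    by apply: onth_some; rewrite -sps; exact: onth_ltn pi.
  by rewrite (rP i p pi); case: (Rps i b p bi pi) => + _; case: (p).
congr Node; apply: eq_from_onth_le => i.
rewrite size_mapi !size_map sps maxnn => li; have [b bi] := onth_some li.
have [|p pi] := @onth_some _ ps i; first by rewrite sps.
rewrite (@onth_pieces _ _ i p.1) ?onth_map ?pi //= (rP i p pi) bi.
by case: (Rps i b p bi pi) => _ ->.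
Qed.

Lemma pieces_valid (C : kind) t r : forest_valid C (t, r) ->
  plane_tree (pieces t r) /\
  all (fun p => `[< piece_valid C p >]) (leaves (pieces t r)).
Proof.
elim/tree_onth_ind: t r => [l|c ts IH] r vt.
  by split=> //=; rewrite andbT; apply/asboolP.
case: c vt => vt; try by split=> //=; rewrite andbT; apply/asboolP.
have /forest_valid_painted[s1 br ok] := vt.
have rec i b : onth (mapi (fun i d => d (shift i r)) (map pieces ts)) i = Some b ->
    exists2 u, onth ts i = Some u & b = pieces u (shift i r).
  rewrite onth_mapi onth_map; case ui: (onth ts i) => [u|] //= [<-].
  by exists u.
rewrite /= size_mapi size_map s1 all_flatten; split.
  by apply/all_onthP => i b /rec[u ui ->]; case: (IH i u ui _ (ok i u ui)).
apply/all_onthP => i s; rewrite onth_map.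
case bi: (onth _ i) => [b|] //= [<-]; have [u ui ->] := rec _ _ bi.
by case: (IH i u ui _ (ok i u ui)).
Qed.

Lemma size_leaves_pieces t r :
  size (leaves t) = sumn (map piece_size (leaves (pieces t r))).
Proof.
elim/tree_onth_ind: t r => [l|c ts IH] r //=.
case: c; rewrite ?[sumn _]/= ?addn0 //.
rewrite size_flatten /shape map_flatten sumn_flatten -!map_comp; congr sumn.
apply: eq_from_onth => i; rewrite !onth_map onth_mapi onth_map.
by case ui: (onth ts i) => [u|] //=; rewrite (IH i u ui (shift i r)).
Qed.

(** No painted node lies above a node that is not painted, so the painted nodes form the base tree,
    with unchanged addresses. Hence the weak order on painted nodes serves for the base as it is. *)
Lemma node_painted_pieces t r v :
  painting t -> node_painted t v <-> is_node (pieces t r) v.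
Proof.
elim/tree_onth_ind: t r v => [l|c ts IH] r v pt.
  by rewrite is_nodeE /node_painted /decoration; case: v.
have [cP|cN] : c = Painted \/ c <> Painted by case: c {pt}; [left|right|right].
  subst c; case: v => [|i v].
    by rewrite is_node_nil /node_painted /decoration.
  rewrite [pieces _ _]/= is_node_cons /node_painted decoration_cons.
  rewrite onth_mapi onth_map; case ui: (onth ts i) => [u|] //=.
  by apply: (IH i u ui); case/painting_node: pt => pts _; exact: pts ui.
rewrite pieces_unpainted; last by case: c cN {pt}.
have -> : is_node (Leaf unit (Node c ts, r)) v = false by case: v.
split=> //; case: v => [|i v].
  by rewrite /node_painted /decoration /= => -[].
rewrite /node_painted decoration_cons; case ui: (onth ts i) => [u|] // du.
case/painting_node: pt => _ /(_ cN i u v ui).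
by rewrite /is_node /node_unpainted du => /(_ isT).
Qed.

(** Exchanges a structure whose type depends on the tree for a relation whose type does not;
    [forest_on] describes exactly the values taken. *)
Definition forest_rel (C : kind) (t : tree unit paint) :
    forest_structure C t -> rel address :=
  match C with
  | WeaklyOrderedTrees => fun s => proj1_sig s
  | _ => fun=> no_rel
  end.

Definition base_rel (D : kind) (t : tree unit paint) :
    base_structure D t -> rel address :=
  match D with
  | WeaklyOrderedTrees => fun s => proj1_sig s
  | _ => fun=> no_rel
  end.

Lemma forest_relP C t (s : forest_structure C t) : forest_on C t (forest_rel s).
Proof. by case: C s => //= -[]. Qed.

Lemma base_relP D t (s : base_structure D t) :
  order_on D (node_painted t) (base_rel s).
Proof. by case: D s => //= -[]. Qed.

Lemma forest_rel_inj C t : injective (@forest_rel C t).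
Proof.
case: C => /=.
- by move=> s s' _; exact: Prop_irrelevance.
- by case=> -[].
- by case=> r rP [r' rP'] /= e; apply: eq_exist.
Qed.

Lemma base_rel_inj D t : injective (@base_rel D t).
Proof.
case: D => /=.
- by move=> s s' _; exact: Prop_irrelevance.
- by case=> -[].
- by case=> r rP [r' rP'] /= e; apply: eq_exist.
Qed.

Lemma forest_rel_surj C t r : forest_on C t r -> exists s, @forest_rel C t s = r.
Proof.
case: C => /=; [by case=> s ->; exists s|by move=> ->; exists I|].
by move=> rP; exists (exist _ r rP).
Qed.

Lemma base_rel_surj D t r :
  order_on D (node_painted t) r -> exists s, @base_rel D t s = r.
Proof.
case: D => /=; [by case=> s ->; exists s|by move=> ->; exists I|].
by move=> rP; exists (exist _ r rP).
Qed.

(** The outer shape is the base tree, depending on [D] alone, and the inner shapes are the pieces,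
    depending on [C] alone. It thus suffices to find shapings separately for each [D] and each
    [C]. *)
Lemma types_of_subst (C D : kind) (G H : species) :
  shaping G (ordered_tree_valid D) ordered_tree_size ->
  shaping H (piece_valid C) piece_size ->
  types_of_painted_trees C D (subst_species G H).
Proof.
move=> g h.
have gt0 p : piece_valid C p -> 0 < piece_size p.
  by case=> _ [pt _ _]; exact: leaves_gt0.
pose tr (p : painted_tree C D) := pieces (ptree p) (forest_rel (ptree_forest p)).
have fv (p : painted_tree C D) :
    forest_valid C (ptree p, forest_rel (ptree_forest p)).
  by split; [exact: ptree_plane|exact: ptree_painting|exact: forest_relP].
(* The base tree labeled by pieces is split into its unlabeled tree and its list of labels from left
   to right, the form of a shape of a substitution. *)
pose b (p : painted_tree C D) : ordered_tree * seq forest_tree :=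
  ((forget_leaves (tr p), base_rel (ptree_base p)), leaves (tr p)).
have painted_is_node t r : painting t ->
    node_painted t = is_node (forget_leaves (pieces t r)).
  move=> pt; rewrite is_node_forget; apply/funext => v; apply/propext.
  exact: node_painted_pieces.
apply: (types_of_shaping (b := b) (shaping_subst g h gt0)).
- case=> t pt at_ ft bt [t' pt' at' ft' bt'] [] e er e'.
  have := @pieces_inj C _ _ _ _ (fv (PaintedTree pt at_ ft bt))
    (fv (PaintedTree pt' at' ft' bt')) (forget_leaves_inj e e') => -[/= et ef].
  subst t'; move/forest_rel_inj: ef => <-; move/base_rel_inj: er => /= <-.
  by rewrite (Prop_irrelevance pt' pt) (Prop_irrelevance at' at_).
- move=> p; have [pl vl] := pieces_valid (fv p); split.
  + split; first by rewrite /= plane_forget.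
    rewrite /= -painted_is_node; first exact: base_relP.
    exact: ptree_painting.
  + by rewrite /ordered_tree_size /= size_forget_leaves.
  + by move=> i u /= ui; apply/asboolP; move/all_onthP: vl => /(_ i u ui).
- move=> [[u r] us] [/= [/= pu ou] sus vus].
  have [tau tauE tauL] := forget_leaves_surj sus.
  have [||[t f] [/= pt at_ ft] pE] := @pieces_surj C tau.
  + by rewrite -plane_forget tauE.
  + by rewrite tauL; apply/all_onthP => i x /vus /asboolP.
  have [fs fsE] := forest_rel_surj ft.
  have [bs bsE] : exists s, @base_rel D t s = r.
    by apply: base_rel_surj; rewrite (painted_is_node t f) // pE tauE.
  exists (PaintedTree pt at_ fs bs).
  by rewrite /b /tr /= fsE bsE pE tauE tauL.
move=> p; rewrite /num_leaves (size_leaves_pieces _ (forest_rel (ptree_forest p))).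
by [].
Qed.

(** * Shapes of the grafted pieces *)

Fixpoint map_nodes (L N N' : Type) (f : N -> N') (t : tree L N) : tree L N' :=
  match t with
  | Leaf l => Leaf N' l
  | Node c ts => Node (f c) (map (map_nodes f) ts)
  end.

Lemma leaves_map_nodes (L N N' : Type) (f : N -> N') (t : tree L N) :
  leaves (map_nodes f t) = leaves t.
Proof.
elim/tree_onth_ind: t => [l|c ts IH] //=; congr flatten; rewrite -map_comp.
by apply: eq_from_onth => i; rewrite !onth_map; case ui: onth => [u|] //=; rewrite (IH i).
Qed.

Lemma plane_map_nodes (L N N' : Type) (f : N -> N') (t : tree L N) :
  plane_tree (map_nodes f t) = plane_tree t.
Proof.
elim/tree_onth_ind: t => [l|c ts IH] //=; rewrite size_map all_map; congr andb.
by apply/idP/idP => /all_onthP pts; apply/all_onthP => i u ui; have := pts i u ui;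
  rewrite /= (IH i).
Qed.

Lemma decoration_map_nodes (L N N' : Type) (f : N -> N') (t : tree L N) v :
  decoration (map_nodes f t) v = omap f (decoration t v).
Proof.
elim: v t => [|i v IH] [l|c ts] //=.
by rewrite !decoration_cons onth_map; case: onth => //= u.
Qed.

Lemma map_nodes_comp (L N N' N'' : Type) (f : N -> N') (g : N' -> N'') (t : tree L N) :
  map_nodes g (map_nodes f t) = map_nodes (g \o f) t.
Proof.
elim/tree_onth_ind: t => [l|c ts IH] //=; congr Node; rewrite -map_comp.
by apply: eq_from_onth => i; rewrite !onth_map; case ui: onth => [u|] //=; rewrite (IH i).
Qed.

Lemma map_nodes_id (L N : Type) (f : N -> N) (t : tree L N) :
  (forall v c, decoration t v = Some c -> f c = c) -> map_nodes f t = t.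
Proof.
elim/tree_onth_ind: t => [l|c ts IH] //= fc; congr Node; first exact: (fc [::]).
apply: eq_from_onth => i; rewrite onth_map; case ui: (onth ts i) => [u|] //=.
rewrite (IH i u ui) // => v d dv; apply: (fc (i :: v)).
by rewrite decoration_cons ui.
Qed.

Definition erase (t : tree unit paint) : tree unit unit := map_nodes (fun=> tt) t.

Definition unpaint (u : tree unit unit) : tree unit paint :=
  map_nodes (fun=> Unpainted) u.

Definition half_paint (us : seq (tree unit unit)) : tree unit paint :=
  Node HalfPainted (map unpaint us).

Lemma unpaintK : cancel unpaint erase.
Proof. by move=> u; rewrite /erase map_nodes_comp map_nodes_id // => v []. Qed.

Lemma half_paint_inj : injective half_paint.
Proof. by move=> us us' []; apply: inj_map; exact: can_inj unpaintK. Qed.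

Lemma half_paint_neq u us : unpaint u <> half_paint us.
Proof. by case: u. Qed.

Lemma eraseK t :
  (forall v, is_node t v -> node_unpainted t v) -> unpaint (erase t) = t.
Proof.
move=> tU; rewrite /unpaint map_nodes_comp map_nodes_id // => v c cv.
by have := tU v; rewrite /is_node /node_unpainted cv => /(_ isT) [].
Qed.

Lemma is_node_unpaint u v : is_node (unpaint u) v = is_node u v.
Proof. by rewrite /is_node decoration_map_nodes; case: decoration. Qed.

Lemma decoration_unpaint u v :
  decoration (unpaint u) v = if is_node u v then Some Unpainted else None.
Proof. by rewrite decoration_map_nodes /is_node; case: decoration. Qed.

Lemma unpainted_unpaint u v : node_unpainted (unpaint u) v <-> is_node u v.
Proof. by rewrite /node_unpainted decoration_unpaint; case: is_node. Qed.

Lemma painting_unpaint u : painting (unpaint u).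
Proof. by move=> v w _ nw _ _; apply/unpainted_unpaint; rewrite -is_node_unpaint. Qed.

Lemma decoration_half us i v :
  decoration (half_paint us) (i :: v) =
  if is_node (Node tt us) (i :: v) then Some Unpainted else None.
Proof.
rewrite decoration_cons is_node_cons onth_map.
by case: onth => //= u; rewrite decoration_unpaint.
Qed.

Definition above_root (us : seq (tree unit unit)) (v : address) : Prop :=
  v <> [::] /\ is_node (Node tt us) v.

Lemma unpainted_half us v : node_unpainted (half_paint us) v <-> above_root us v.
Proof.
rewrite /node_unpainted /above_root; case: v => [|i v].
  by split=> [|[]//]; rewrite /decoration.
by rewrite decoration_half; case: is_node; split=> // -[].
Qed.

Lemma painting_half us : painting (half_paint us).
Proof.
apply/painting_node; split=> [i u|_ i u v]; rewrite onth_map;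
  case: onth => //= u' [<-].
  exact: painting_unpaint.
by rewrite is_node_unpaint => nv; apply/unpainted_unpaint.
Qed.

Lemma plane_half us :
  plane_tree (half_paint us) = (1 < size us) && all (@plane_tree _ _) us.
Proof.
rewrite /= size_map all_map; congr andb; apply: eq_all => u /=.
exact: plane_map_nodes.
Qed.

Variant piece_spec : tree unit paint -> Prop :=
  | PieceUnpainted u of plane_tree u : piece_spec (unpaint u)
  | PieceHalf us of 1 < size us & all (@plane_tree _ _) us :
      piece_spec (half_paint us).

(** A root node that is not painted forces all other nodes to be unpainted, so only the paint of the
    root is free. *)
Lemma pieceP t :
  plane_tree t -> painting t -> ~~ painted_root t -> piece_spec t.
Proof.
case: t => [[]|c ts] pt at_ rt; first exact: (@PieceUnpainted (Leaf unit tt)).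
have cP : c <> Painted by move: rt; case: c {pt at_}.
have /painting_node[_ /(_ cP) ts_u] := at_.
have [cH|cU] : c = HalfPainted \/ c = Unpainted by case: c cP {pt at_ rt ts_u}; auto.
  have tsE : map unpaint (map erase ts) = ts.
    apply: eq_from_onth => i; rewrite !onth_map; case ui: (onth ts i) => [u|] //=.
    by rewrite eraseK // => v; exact: ts_u ui.
  subst c; move: pt; rewrite -tsE -/(half_paint _) plane_half.
  by case/andP => s1 pl; exact: PieceHalf.
have tE : unpaint (erase (Node c ts)) = Node c ts.
  apply: eraseK => -[|i v]; first by rewrite cU.
  rewrite is_node_cons; case ui: (onth ts i) => [u|] // nv.
  by apply/unpainted_cons; exists u; last exact: ts_u ui nv.
by rewrite -tE; apply: PieceUnpainted; rewrite plane_map_nodes.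
Qed.

Lemma weak_order_congr (E E' : address -> address -> Prop) r :
  (forall v w, E v w <-> E' v w) -> weak_order E r <-> weak_order E' r.
Proof.
move=> EE; have -> // : E = E'.
by apply/funext => v; apply/funext => w; exact/propext.
Qed.

(** As soon as there is a node, the root is one, and any other node is strictly above it. *)
Lemma single_nodeP (u : tree unit unit) :
  (forall v w, is_node u v -> is_node u w -> v = w) <->
  (forall v w, is_node u v -> is_node u w -> ~ strictly_above w v).
Proof.
split=> [h v w nv nw|h].
  by rewrite (h v w nv nw) /strictly_above eqxx andbF.
have root v : is_node u v -> v = [::].
  move=> nv; apply/eqP/negPn; rewrite -strictly_above_nil; apply/negP.
  by apply: (h [::] v) => //; case: u nv {h} => //; case: v.
by move=> v w /root -> /root ->.
Qed.

Lemma forest_on_unpaint C u r :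
  forest_on C (unpaint u) r <-> order_on C (is_node u) r.
Proof.
case: C => //=.
  rewrite single_nodeP; split=> -[h ->]; split=> // v w.
    by move=> /unpainted_unpaint nv /unpainted_unpaint; exact: h.
  by move=> /unpainted_unpaint nv /unpainted_unpaint; exact: h.
apply: weak_order_congr => v w; split=> [[]|[]].
  by move=> /unpainted_unpaint + /unpainted_unpaint.
move=> nv nw; split; try exact/unpainted_unpaint.
by move=> x _; rewrite /node_painted decoration_unpaint; case: is_node.
Qed.

(** The half-painted root is not among the unpainted nodes, and nodes of different branches are
    incomparable, so the conditions bear on each branch separately. *)
Lemma forest_on_half C us r : C <> WeaklyOrderedTrees ->
  forest_on C (half_paint us) r <->
  r = no_rel /\ forall i u, onth us i = Some u -> order_on C (is_node u) no_rel.
Proof.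
case: C => //= _; last by split=> [|[]].
split=> [[h ->]|[-> h]].
  split=> // i u ui; split=> //; apply/single_nodeP => v w nv nw.
  have := h (i :: v) (i :: w); rewrite strictly_above_cons eqxx.
  by apply; apply/unpainted_half; split=> //; rewrite is_node_cons ui.
split=> // -[|i v] [|j w] /unpainted_half[// _ nv] /unpainted_half[// _ nw].
rewrite strictly_above_cons; case: eqP => // ij; subst j.
move: nv nw; rewrite !is_node_cons; case ui: (onth us i) => [u|] // nv nw.
by have [/single_nodeP hu _] := h i u ui; exact: hu.
Qed.

(** A half-painted root does not separate its branches: paths through it meet no painted node. A
    single weak order therefore compares the nodes of all branches. *)
Lemma forest_on_half_ordered us r :
  forest_on WeaklyOrderedTrees (half_paint us) r <->
  weak_order (fun v w => above_root us v /\ above_root us w) r.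
Proof.
apply: weak_order_congr => v w; split=> [[]|[]].
  by move=> /unpainted_half + /unpainted_half.
move=> nv nw; split; try exact/unpainted_half.
move=> [|i x] _; first by rewrite /node_painted /decoration.
by rewrite /node_painted decoration_half; case: is_node.
Qed.

Lemma piece_valid_unpaint C u r :
  piece_valid C (unpaint u, r) <-> ordered_tree_valid C (u, r).
Proof.
rewrite /piece_valid /forest_valid /ordered_tree_valid /= plane_map_nodes.
split=> [[_ [pu _ /forest_on_unpaint]]|[pu ou]] //; split; first by case: u {pu ou}.
by split=> //; [exact: painting_unpaint|exact/forest_on_unpaint].
Qed.

Lemma piece_valid_half C us r :
  piece_valid C (half_paint us, r) <->
  [/\ 1 < size us, all (@plane_tree _ _) us & forest_on C (half_paint us) r].
Proof.
rewrite /piece_valid /forest_valid [painted_root _]/= [(_, _).1]/=.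
rewrite plane_half; split=> [[_ [/andP[]]]|[s1 p h]] //.
by split=> //; split=> //; [rewrite s1|exact: painting_half].
Qed.

(** * Pieces as non-empty lists of trees *)

Lemma pair_corolla (p : ordered_tree) (us : seq ordered_tree) :
  ordered_tree_valid Corollas p -> size us = ordered_tree_size p ->
  p = corolla (size us).
Proof. by move=> + -> => /valid_corolla. Qed.

(** A one-element list is the piece without half-painted root. The outer corolla is not read: for
    valid pairs the length of the list determines it. *)
Definition list_to_piece (p : ordered_tree * seq ordered_tree) : forest_tree :=
  if p.2 is [:: u] then (unpaint u.1, u.2) else (half_paint (map fst p.2), no_rel).

Lemma list_to_pieceE p : 1 < size p.2 ->
  list_to_piece p = (half_paint (map fst p.2), no_rel).
Proof. by case: p => t [|u [|u' us]]. Qed.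

Lemma piece_size_unpaint u r : piece_size (unpaint u, r) = ordered_tree_size (u, r).
Proof. by rewrite /piece_size leaves_map_nodes. Qed.

Lemma piece_size_half us r :
  piece_size (half_paint us, r) = size (leaves (Node tt us)).
Proof.
rewrite /piece_size /= -map_comp; congr (size (flatten _)).
by apply: eq_map => u /=; rewrite leaves_map_nodes.
Qed.

Lemma shaping_list_pieces (C : kind) (G : species) : C <> WeaklyOrderedTrees ->
  shaping G (ordered_tree_valid C) ordered_tree_size ->
  shaping (subst_species L_plus G) (piece_valid C) piece_size.
Proof.
move=> CW g.
have gt0 p : ordered_tree_valid C p -> 0 < ordered_tree_size p.
  by case=> pt _; exact: leaves_gt0.
have rel0 (q : ordered_tree) : ordered_tree_valid C q -> q.2 = no_rel.
  by case: q => u r [_]; case: C CW {g gt0} => //= _ [].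
have szp p : subst_valid (ordered_tree_valid Corollas) (ordered_tree_valid C)
    ordered_tree_size p -> 0 < size p.2.
  by case=> -[pt _] -> _; exact: leaves_gt0.
have cases p : subst_valid (ordered_tree_valid Corollas) (ordered_tree_valid C)
    ordered_tree_size p -> (exists u, p.2 = [:: u]) \/ 1 < size p.2.
  move=> /szp; case: (p.2) => [|u [|u' us]] //; last by right.
  by left; exists u.
apply: (shaping_transfer (phi := list_to_piece) _ _ _ _
         (shaping_subst shaping_L_plus g gt0)) => [p Vp|p Vp|p q Vp Vq|[t r]].
- have [_ _ Vus] := Vp; have [[u pu]|s1] := cases p Vp.
    rewrite /list_to_piece pu; apply/piece_valid_unpaint.
    rewrite -surjective_pairing; apply: (Vus 0); by rewrite pu.
  rewrite list_to_pieceE //; apply/piece_valid_half; rewrite size_map; split=> //.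
    by rewrite all_map; apply/all_onthP => i u /Vus[].
  apply/forest_on_half => //; split=> // i u; rewrite onth_map.
  case ui: onth => [v|] //= [<-]; have [_] := Vus i v ui.
  by rewrite (rel0 v (Vus i v ui)).
- rewrite /subst_size; have [[u pu]|s1] := cases p Vp.
    by rewrite /list_to_piece pu piece_size_unpaint /= addn0; case: u {pu}.
  rewrite list_to_pieceE // piece_size_half /= size_flatten /shape -!map_comp.
  by [].
- have pq2 : p.2 = q.2 -> p = q.
    case: p Vp => p us [/= Vp sp _]; case: q Vq => q us' [/= Vq sq _] e.
    by subst us'; rewrite (pair_corolla Vp sp) (pair_corolla Vq sq).
  have [[u pu]|sp] := cases p Vp; have [[u' qu]|sq] := cases q Vq.
  + rewrite /list_to_piece pu qu => -[/(can_inj unpaintK) e1 e2]; apply: pq2.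
    by rewrite pu qu (surjective_pairing u) e1 e2 -surjective_pairing.
  + by rewrite (list_to_pieceE sq) /list_to_piece pu => -[/half_paint_neq].
  + by rewrite (list_to_pieceE sp) /list_to_piece qu => -[/esym/half_paint_neq].
  rewrite !list_to_pieceE // => /(congr1 fst)/half_paint_inj e; apply: pq2.
  (* Grafting on the half-painted root forgets the relations of the trees, but for the kinds
     considered here they all equal [no_rel]. *)
  have back (x : ordered_tree * seq ordered_tree) :
      subst_valid (ordered_tree_valid Corollas) (ordered_tree_valid C)
        ordered_tree_size x -> map (fun u => (u, no_rel)) (map fst x.2) = x.2.
    move=> [_ _ Vx]; rewrite -map_comp; apply: eq_from_onth => i; rewrite onth_map.
    case ui: (onth x.2 i) => [v|] //=.
    by rewrite -(rel0 v (Vx i v ui)) -surjective_pairing.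
  by rewrite -(back p Vp) -(back q Vq) e.
move=> [rt []] /= pt at_; have [] := pieceP pt at_ rt.
  move=> u pu /forest_on_unpaint ou; exists (corolla 1, [:: (u, r)]) => //.
  split=> //=; first exact: corolla_valid.
  by case=> [|[]] // v [<-].
move=> us s1 pus /(forest_on_half _ _ CW)[-> ou].
exists (corolla (size us), [seq (u, no_rel) | u <- us]).
  split=> /=; first by apply: corolla_valid; exact: ltnW.
    by rewrite size_map corolla_size.
  move=> i p; rewrite onth_map; case ui: (onth us i) => [u|] //= [<-].
  by split; [move/all_onthP: pus => /(_ i u ui)|exact: ou ui].
by rewrite list_to_pieceE ?size_map //= -map_comp map_id.
Qed.

(** * Pieces as trees whose root may be half-painted *)

Definition above_root_rel (r : rel address) : rel address :=
  fun v w => [&& r v w, v != [::] & w != [::]].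

Lemma above_root_weak_order (us : seq (tree unit unit)) r :
  weak_order (fun v w => is_node (Node tt us) v /\ is_node (Node tt us) w) r ->
  weak_order (fun v w => above_root us v /\ above_root us w) (above_root_rel r).
Proof.
case=> rE rT rC rA; split.
- by move=> v w /and3P[/rE[nv nw] /eqP v0 /eqP w0].
- move=> v w [[/eqP v0 nv] [/eqP w0 nw]].
  by rewrite /above_root_rel v0 w0 !andbT; apply: rT.
- move=> v w x /and3P[wv w0 v0] /and3P[vx _ x0].
  by rewrite /above_root_rel w0 x0 (rC v).
- move=> v w [[/eqP v0 nv] [/eqP w0 nw]] wv; rewrite /above_root_rel v0 w0 !andbT.
  exact: rA.
Qed.

(* The root comes strictly before every other node in any weak order. *)
Lemma above_root_rel_inj (us : seq (tree unit unit)) r r' :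
  weak_order (fun v w => is_node (Node tt us) v /\ is_node (Node tt us) w) r ->
  weak_order (fun v w => is_node (Node tt us) v /\ is_node (Node tt us) w) r' ->
  above_root_rel r = above_root_rel r' -> r = r'.
Proof.
have fromroot s v w : weak_order (fun v w => is_node (Node tt us) v /\
    is_node (Node tt us) w) s -> v = [::] \/ w = [::] ->
    s v w = is_node (Node tt us) w && (v == [::]).
  move=> [sE sT _ sA] vw; apply/idP/andP => [svw|[nw /eqP v0]].
    have [nv nw] := sE _ _ svw; split=> //; apply/negPn/negP => v0.
    have w0 : w = [::] by case: vw => // e; rewrite e in v0.
    have := sA [::] v; rewrite strictly_above_nil v0 -w0 svw.
    by move=> /(_ (conj nw nv) isT)/andP[].
  have [->|w0] := eqVneq w [::].
    by rewrite v0 -[s _ _]orbb; apply: sT.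
  have := sA [::] w (conj isT nw); rewrite strictly_above_nil v0.
  by move=> /(_ w0)/andP[].
move=> rW rW' e; apply/funext => v; apply/funext => w.
have [v0|v0] := eqVneq v [::]; first by rewrite (fromroot r) ?(fromroot r'); auto.
have [w0|w0] := eqVneq w [::]; first by rewrite (fromroot r) ?(fromroot r'); auto.
by move/(congr1 (fun s => s v w)): e; rewrite /above_root_rel v0 w0 !andbT.
Qed.

Lemma above_root_rel_surj (us : seq (tree unit unit)) r :
  weak_order (fun v w => above_root us v /\ above_root us w) r ->
  exists2 r', weak_order (fun v w => is_node (Node tt us) v /\
    is_node (Node tt us) w) r' & above_root_rel r' = r.
Proof.
case=> rE rT rC rA.
(* The root is put alone on a new lowest level: it is at most every node, itself included, and no
   other node is at most the root. *)
exists (fun v w => (is_node (Node tt us) w && (v == [::])) || r v w); last first.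
  apply/funext => v; apply/funext => w; rewrite /above_root_rel.
  have [->|/eqP v0] := eqVneq v [::].
    by rewrite /= andbF; apply/esym/negP => /rE[[]].
  have [->|/eqP w0] := eqVneq w [::].
    by rewrite /= andbF; apply/esym/negP => /rE[_ []].
  by rewrite /= andbF andbT.
split.
- move=> v w /orP[/andP[nw /eqP ->]//|/rE[[_ nv] [_ nw]]//].
- move=> v w [nv nw]; rewrite nv nw /=.
  have [->|/eqP v0] := eqVneq v [::]; first by [].
  have [->|/eqP w0] := eqVneq w [::]; first by rewrite !orbT.
  by rewrite /= rT.
- move=> v w x /orP[/andP[nv /eqP ->]|wv] /orP[/andP[nx /eqP v0]|vx].
  + by rewrite nx eqxx.
  + by have [_ [_ ->]] := rE _ _ vx; rewrite eqxx.
  + by move: wv; rewrite v0 => /rE[_ []].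
  + by rewrite (rC v w x wv vx) orbT.
- move=> v w [nv nw] wv; rewrite nv nw /=.
  have w0 : w <> [::] by move=> w0; rewrite w0 strictly_above_nilP in wv.
  have [v0|/eqP v0] := eqVneq v [::].
    by rewrite /= negb_or; apply/andP; split; [exact/eqP|apply/negP => /rE[_ []]].
  by have /eqP/negPf-> := w0; rewrite /= rA.
Qed.

(** The value on a leaf is a default: a tree with at least two leaves has a node as its root. *)
Definition half_root (u : tree unit unit) : tree unit paint :=
  if u is Node _ us then half_paint us else Leaf paint tt.

Definition sum_to_piece (p : ordered_tree + ordered_tree) : forest_tree :=
  match p with
  | inl p => (unpaint p.1, p.2)
  | inr p => (half_root p.1, above_root_rel p.2)
  end.

(** The second summand becomes the pieces with half-painted root, the level of the root being
    dropped from the order. Corollas are excluded because the branches over a half-painted root may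
    have nodes of their own, so the underlying tree need not be a corolla. *)
Lemma shaping_twice_pieces (C : kind) (G : species) : C <> Corollas ->
  shaping G (ordered_tree_valid C) ordered_tree_size ->
  shaping (twice_minus_x G) (piece_valid C) piece_size.
Proof.
move=> CC g; have above0 : above_root_rel no_rel = no_rel by [].
have half (u : tree unit unit) : plane_tree u -> 1 < size (leaves u) ->
    exists us, u = Node tt us.
  by move=> pu; rewrite leaves_gt1 //; case: u {pu} => // -[] us; exists us.
apply: (shaping_transfer (phi := sum_to_piece) _ _ _ _
         (shaping_sum g (shaping_ge2 g))) => [[]|[]|[]|[t r]].
- by move=> [u r] Vu; apply/piece_valid_unpaint.
- move=> [u r] [[/= pu ou] su]; have [us uE] := half u pu su; subst u.
  apply/piece_valid_half; case/andP: pu => s1 pus; split=> //.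
  case: C CC ou {g} => //= _; first by move=> ->; rewrite above0.
  by move=> ou; apply/forest_on_half_ordered; exact: above_root_weak_order.
- by move=> [u r] _; exact: piece_size_unpaint.
- move=> [u r] [[/= pu _] su]; have [us uE] := half u pu su; subst u.
  exact: piece_size_half.
- move=> [u r] [[u' r']|[u' r']] _ /=.
    by move=> _ [/(can_inj unpaintK) -> ->].
  move=> [[/= pu _] su] []; have [us uE] := half u' pu su; subst u'.
  by move/half_paint_neq.
- move=> [u r] [[u' r']|[u' r']] [[/= pu ou] su].
    by have [us ->] := half u pu su; move=> _ [/esym/half_paint_neq].
  move=> [[/= pu' ou'] su'].
  have [us uE] := half u pu su; have [us' uE'] := half u' pu' su'; subst u u'.
  move=> /[dup] /(congr1 fst)/half_paint_inj ? /(congr1 snd) /=; subst us'.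
  case: C CC ou ou' {g} => //= _; first by move=> -> ->.
  by move=> ou ou' /(above_root_rel_inj ou ou') ->.
move=> [rt []] /= pt at_; have [] := pieceP pt at_ rt.
  by move=> u pu /forest_on_unpaint ou; exists (inl (u, r)).
move=> us s1 pus ft.
have pu : plane_tree (Node tt us) by apply/andP.
have su : 1 < ordered_tree_size (Node tt us, no_rel).
  by rewrite /ordered_tree_size leaves_gt1.
case: C CC ft {g} => //= _.
  by move=> ->; exists (inr (Node tt us, no_rel)); rewrite /= ?above0.
move=> /forest_on_half_ordered/above_root_rel_surj[r' rW <-].
by exists (inr (Node tt us, r')).
Qed.

(** * Assembling the nine cases and the isomorphisms *)

Local Open Scope species_scope.

Theorem theorem3p6 :
  [/\ [/\ types_of_painted_trees Corollas Corollas (L_plus ⊙ (L_plus ⊙ L_plus)),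
          types_of_painted_trees Corollas PlaneTrees (Y ⊙ (L_plus ⊙ L_plus))
        & types_of_painted_trees Corollas WeaklyOrderedTrees
            (F ⊙ (L_plus ⊙ L_plus))],
      [/\ types_of_painted_trees PlaneTrees Corollas (L_plus ⊙ (L_plus ⊙ Y))
            /\ L_plus ⊙ (L_plus ⊙ Y) ≅ L_plus ⊙ twice_minus_x Y,
          types_of_painted_trees PlaneTrees PlaneTrees (Y ⊙ (L_plus ⊙ Y))
            /\ Y ⊙ (L_plus ⊙ Y) ≅ Y ⊙ twice_minus_x Y
        & types_of_painted_trees PlaneTrees WeaklyOrderedTrees (F ⊙ (L_plus ⊙ Y))
            /\ F ⊙ (L_plus ⊙ Y) ≅ F ⊙ twice_minus_x Y]
    & [/\ types_of_painted_trees WeaklyOrderedTrees Corollas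
            (L_plus ⊙ twice_minus_x F),
          types_of_painted_trees WeaklyOrderedTrees PlaneTrees
            (Y ⊙ twice_minus_x F)
        & types_of_painted_trees WeaklyOrderedTrees WeaklyOrderedTrees
            (F ⊙ twice_minus_x F)]].
Proof.
have LL : shaping (L_plus ⊙ L_plus) (piece_valid Corollas) piece_size.
  by apply: shaping_list_pieces => //; exact: shaping_L_plus.
have LY : shaping (L_plus ⊙ Y) (piece_valid PlaneTrees) piece_size.
  by apply: shaping_list_pieces => //; exact: shaping_Y.
have YY : shaping (twice_minus_x Y) (piece_valid PlaneTrees) piece_size.
  by apply: shaping_twice_pieces => //; exact: shaping_Y.
have FF : shaping (twice_minus_x F) (piece_valid WeaklyOrderedTrees) piece_size.
  by apply: shaping_twice_pieces => //; exact: shaping_F.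
(* The inner species on both sides have the same shapes, the pieces, so the two substitutions have
   the same shapes as well. *)
have iso D (G : species) : shaping G (ordered_tree_valid D) ordered_tree_size ->
    G ⊙ (L_plus ⊙ Y) ≅ G ⊙ twice_minus_x Y.
  move=> g; have gt0 p : piece_valid PlaneTrees p -> 0 < piece_size p.
    by case=> _ [pt _ _]; exact: leaves_gt0.
  exact: shaping_iso (shaping_subst g LY gt0) (shaping_subst g YY gt0).
have L := shaping_L_plus; have tY := shaping_Y; have tF := shaping_F.
by split; split; try split; try exact: types_of_subst; apply: iso; eassumption.
Qed.
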